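(* Let $k\ge 2$ be a fixed integer and let $q=q(n)\ge n-1$. Then with high probability (i.e. with probability tending to $1$ as $n\to\infty$) the randomly coloured random multigraph $G_{k,q}(n)$ contains a rainbow spanning tree, i.e. a spanning tree of the underlying multigraph whose $n-1$ edges have pairwise distinct colours.
   Context: The random multigraph $G_{k-out}=G_{k-out}(n)$ has vertex set $[n]=\{1,\dots,n\}$; each vertex $i\in[n]$ independently chooses a set of $k$ distinct neighbours from $[n]\setminus\{i\}$, uniformly among all $\binom{n-1}{k}$ such sets, and each choice gives an edge, so $G_{k-out}$ has exactly $kn$ edges (if $i$ chooses $j$ and $j$ chooses $i$, this gives two parallel edges). The randomly coloured graph $G_{k,q}=G_{k,q}(n)$ is obtained as follows: there is a set $Q$ of $q$ colours; let $\rho=\lfloor kn/q\rfloor$; a multiset of $kn$ colours is formed in which $kn-q\rho$ of the colours (the popular ones) appear $\rho+1$ times and the remaining colours appear $\rho$ times; this multiset of $kn$ colours is assigned to the $kn$ edges of $G_{k-out}$ by a uniformly random bijection. A set of edges is rainbow if its edges have pairwise different colours. *)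

(* Defs.v *)
From HB Require Import structures.
From mathcomp Require Import all_boot all_order all_algebra.
From mathcomp Require Import boolp reals.
Set Implicit Arguments.
Unset Strict Implicit.
Unset Printing Implicit Defensive.
Import Order.TTheory GRing.Theory Num.Theory.
Local Open Scope ring_scope.

(* A finite multigraph is given by a vertex type V, an edge type E and the
   map ends sending an edge to its two endpoints, listed in either order. *)
Section Multigraph.
Variables (V E : finType) (ends : E -> V * V).

Definition joins (e : E) (u v : V) : bool :=
  (ends e == (u, v)) || (ends e == (v, u)).

(* The pairs (v_1, e_1), ..., (v_m, e_m) encode the closed walk
   v_1 e_1 v_2 e_2 ... v_m e_m v_1.  Two parallel edges form a cycle with
   m = 2 and a loop forms a cycle with m = 1. *)
Definition is_graph_cycle (T : {set E}) (s : seq (V * E)) : bool :=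
  [&& s != [::], uniq (unzip1 s), uniq (unzip2 s),
      all [in T] (unzip2 s) & cycle (fun x y => joins x.2 x.1 y.1) s].

Definition graph_acyclic (T : {set E}) : Prop :=
  forall s : seq (V * E), ~~ is_graph_cycle T s.

Definition graph_connected (T : {set E}) : Prop :=
  forall u v : V, connect (fun x y => [exists e in T, joins e x y]) u v.

Definition is_spanning_tree (T : {set E}) : Prop :=
  graph_connected T /\ graph_acyclic T.

Definition rainbow (C : eqType) (col : E -> C) (T : {set E}) : Prop :=
  {in T &, injective col}.

Definition has_rainbow_spanning_tree (C : eqType) (col : E -> C) : Prop :=
  exists2 T : {set E}, is_spanning_tree T & rainbow col T.

End Multigraph.

Definition unif (R : realType) (T : finType) (A : {set T}) (x : T) : R :=
  (x \in A)%:R / #|A|%:R.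

Definition neighbour_sets (n k : nat) (i : 'I_n) : {set {set 'I_n}} :=
  [set S : {set 'I_n} | (#|S| == k) && (i \notin S)].

(* The edge (i, j) records that i chooses j, so (i, j) and (j, i) are
   different, parallel edges. *)
Notation kout_edge c := {e : 'I__ * 'I__ | e.2 \in c e.1}.

Definition kout_ends (n : nat) (c : {ffun 'I_n -> {set 'I_n}})
  (e : kout_edge c) : 'I_n * 'I_n := val e.

(* The multiset of colours in which x has multiplicity rho + 1 if x is in
   pop and rho otherwise: its elements are the pairs of a colour and the
   index of one of its copies. *)
Notation colour_copy rho pop := {x : 'I__ & 'I_(rho + (x \in pop))}.

Definition bijections (A B : finType) : {set {ffun A -> B}} :=
  [set f : {ffun A -> B} | `[< bijective f >]].

(* The probability that G_{k,q}(n) contains a rainbow spanning tree, where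
   pop is the set of popular colours.  An outcome consists of the sets c i
   chosen by the vertices, which are independent and uniform, and of a
   bijection b from the edges of the resulting multigraph to the multiset of
   colours, which is uniform given c. *)
Definition prob_rainbow_spanning_tree (R : realType) (n k q : nat)
    (pop : {set 'I_q}) : R :=
  let rho := ((k * n) %/ q)%N in
  \sum_(c : {ffun 'I_n -> {set 'I_n}})
    (\prod_(i < n) unif R (neighbour_sets k i) (c i)) *
    \sum_(b : {ffun kout_edge c -> colour_copy rho pop})
      unif R (bijections _ _) b *
      (`[< has_rainbow_spanning_tree (@kout_ends n c)
             (fun e => tag (b e)) >])%:R.

(* Main.v *)
Require Import Defs.
From HB Require Import structures.
From mathcomp Require Import all_boot all_order all_algebra.
From mathcomp Require Import boolp reals.
From mathcomp Require Import zify ring lra.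
Set Implicit Arguments.
Unset Strict Implicit.
Unset Printing Implicit Defensive.
Import Order.TTheory GRing.Theory Num.Theory.

(* By Rado's theorem for the graphic matroid, the only obstruction to a rainbow
   spanning tree is a partition of the vertices into [K >= 2] blocks whose
   crossing edges carry at most [K - 2] colours, so a union bound over
   partitions suffices.

   Write [t = K - 2] and let [e] be the number of crossing edges.  Moving a copy
   from a small colour class to a larger one only makes it more likely that [e]
   random edges carry at most [t] colours.  Hence one may assume that there are
   [n - 1] classes of size [k] and [k] uncoloured edges, whatever [q >= n - 1]
   is, and the conditional probability given the graph is at most
   [C(n-1, t) C(k(t+1), e) / C(kn, e)].  Up to a constant the last quotient is
   [(n-1)^(k(t+1)-e) / C(kn, k(t+1))]; averaging [(n-1)^(-e)] over the graph
   gives at most the product of [(|A| / (n-1))^(k|A|)] over the blocks [A].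

   The sum of these products over all partitions into [j + 1] blocks is
   dominated by one giant block and [j] singletons: the weights
   [d i = (i+1)^(k(i+1)) / (i+1)!] satisfy
   [\sum_(0 < i < r) d i * d (r - i) <= 3/4 * d r].  The total contribution
   of [j + 1] blocks is [O(exp (- j(n-j) / (4n)) / n)], and the failure
   probability is [O(1 / n)]. *)
(** * Rado's condition for rainbow spanning trees *)

Section RainbowTree.
Local Open Scope ring_scope.
Variables (V E C : finType) (ends : E -> V * V) (col : E -> C).
Implicit Types (F G T : {set E}) (J : {set C}) (P : {set {set V}}).

Definition adj F : rel V := fun x y => [exists e in F, joins ends e x y].

Definition crossing P : {set E} :=
  [set e | pblock P (ends e).1 != pblock P (ends e).2].

Lemma joins_sym e x y : joins ends e x y = joins ends e y x.
Proof. by rewrite /joins orbC. Qed.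

Lemma adj_sym F : connect_sym (adj F).
Proof.
apply: sym_connect_sym => x y.
by apply: eq_existsb => e; rewrite joins_sym.
Qed.

(** * Rank in the graphic matroid *)

Definition unit_vec (v : V) : 'rV[rat]_#|V| := delta_mx 0 (enum_rank v).

(** Vectors of the oriented incidence matrix. The dimension of their span is the graphic matroid
    rank, so submodularity comes from linear algebra. *)
Definition edge_vec (e : E) := unit_vec (ends e).1 - unit_vec (ends e).2.

Definition edge_space F := (\sum_(e in F) <<edge_vec e>>)%MS.

Definition grank F := \rank (edge_space F).

Lemma edge_space_sub F G : F \subset G -> (edge_space F <= edge_space G)%MS.
Proof.
move=> /subsetP sFG; rewrite /edge_space; apply/sumsmx_subP => e /sFG eG.
exact: (sumsmx_sup e).
Qed.

Lemma grankS F G : F \subset G -> (grank F <= grank G)%N.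
Proof. by move=> /edge_space_sub /mxrankS. Qed.

Lemma grank_submod F G :
  (grank (F :|: G) + grank (F :&: G) <= grank F + grank G)%N.
Proof.
rewrite /grank -(mxrank_sum_cap (edge_space F)); apply: leq_add; apply: mxrankS.
- rewrite /edge_space; apply/sumsmx_subP => e; rewrite inE => /orP [eF|eG].
    by apply: submx_trans (addsmxSl _ _); apply: (sumsmx_sup e).
  by apply: submx_trans (addsmxSr _ _); apply: (sumsmx_sup e).
by rewrite sub_capmx !edge_space_sub // ?subsetIl ?subsetIr.
Qed.

Lemma joins_vec_sub F e x y :
  e \in F -> joins ends e x y -> (unit_vec x - unit_vec y <= edge_space F)%MS.
Proof.
move=> eF j.
have s : (edge_vec e <= edge_space F)%MS.
  by apply: (sumsmx_sup e) => //; rewrite genmxE.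
move: s; rewrite /edge_vec; case/orP: j => /eqP -> //=.
by rewrite -opprB eqmx_opp.
Qed.

Lemma connect_vec_sub F x y :
  connect (adj F) x y -> (unit_vec x - unit_vec y <= edge_space F)%MS.
Proof.
case/connectP => p; elim: p x => [|z p IHp] x /=.
  by move=> _ ->; rewrite subrr sub0mx.
case/andP => /existsP [e /andP [eF j]] pth lst.
rewrite -(subrKA (unit_vec z)) addmx_sub ?IHp //.
exact: joins_vec_sub j.
Qed.

(** Modulo the edge space, the unit vector of a vertex is that of the representative of its block,
    so the edge vectors and one vector per block span the whole space. *)
Lemma card_leq_grank F P : partition P [set: V] ->
  (forall x y, pblock P x = pblock P y -> connect (adj F) x y) ->
  (#|V| <= grank F + #|P|)%N.
Proof.
move=> partP conP.
have [_ triP _] := and3P partP.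
pose rep (A : {set V}) : 'rV[rat]_#|V| :=
  if [pick x in A] is Some x then unit_vec x else 0.
pose W := (\sum_(A in P) <<rep A>>)%MS.
have full : (1%:M <= edge_space F + W)%MS.
  apply/row_subP => i; rewrite row1 -(enum_valK i).
  set u := enum_val i; rewrite -/(unit_vec u).
  have uP : u \in cover P by rewrite (cover_partition partP) inE.
  have : (unit_vec u - rep (pblock P u) <= edge_space F)%MS.
    rewrite /rep; case: pickP => [x xu|/(_ u)]; last by rewrite mem_pblock uP.
    by apply/connect_vec_sub/conP; apply/esym/same_pblock.
  move=> s; rewrite -(subrK (rep (pblock P u)) (unit_vec u)) addmx_sub_adds //.
  apply: (sumsmx_sup (pblock P u)); first exact: pblock_mem.
  by rewrite genmxE.
have rW : (\rank W <= #|P|)%N.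
  rewrite /W -sum1_card.
  elim/big_rec2: _ => [|A m B AP le]; first by rewrite mxrank0.
  apply: leq_trans (mxrank_adds_leqif _ _) _.
  by rewrite leq_add // genmxE rank_leq_row.
have := mxrankS full; rewrite mxrank1 => le1; apply: leq_trans le1 _.
by apply: leq_trans (mxrank_adds_leqif _ _) _; rewrite leq_add2l.
Qed.

(** If [u] and [v] were not connected, the indicators of the component of [u] and of its complement
    would be independent and annihilated by every edge vector, so the rank would be at most
    [#|V| - 2]. *)
Lemma grank_connected F : (#|V| <= grank F + 1)%N -> graph_connected ends F.
Proof.
move=> rF u v; apply/negPn/negP => nuv.
rewrite -/(adj F) in nuv.
pose X := [pred x | connect (adj F) u x].
pose M : 'M[rat]_(#|V|, 2) :=
  \matrix_(i, j) ((enum_val i \in X) == (j == 0))%:R.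
(* [N] picks the rows of [M] at [u] and [v], which shows that [M] has rank 2. *)
pose N : 'M[rat]_(2, #|V|) :=
  \matrix_(j, i) (i == enum_rank (if j == 0 then u else v))%:R.
have NM : N *m M = 1%:M.
  apply/matrixP => i j; rewrite !mxE.
  rewrite (bigD1 (enum_rank (if i == 0 then u else v))) //= big1 => [|l nl].
    rewrite addr0 !mxE eqxx mul1r enum_rankK.
    case: (i =P 0) => [->|i0].
      by rewrite !inE connect0 eq_sym eqb_id [in RHS]eq_sym.
    rewrite !inE (negbTE nuv).
    case: i i0 => [[|[|i]] //= ?] => [[]|_]; first exact: val_inj.
    by case: j => [[|[|j]] //= ?].
  by rewrite !mxE (negbTE nl) mul0r.
have rM : (2 <= \rank M)%N.
  have := mxrankM_maxr N M; by rewrite NM mxrank1.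
have SM : edge_space F *m M = 0.
  apply/eqP; rewrite -submx0 /edge_space sumsmxMr_gen; apply/sumsmx_subP => e eF.
  rewrite genmxE (eqmxMr _ (genmxE _)) submx0; apply/eqP.
  apply/matrixP => i j; rewrite mulmxBl -!rowE !mxE !enum_rankK !inE.
  suff -> : connect (adj F) u (ends e).1 = connect (adj F) u (ends e).2.
    by rewrite subrr.
  rewrite ![connect _ u _]adj_sym; apply: same_connect; first exact: adj_sym.
  apply: connect1; apply/existsP; exists e; rewrite eF /joins.
  by rewrite -surjective_pairing eqxx.
have := mulmx0_rank_max SM; rewrite -/(grank F); lia.
Qed.

(** * Cycles and spanning trees *)

Lemma cycle_edge_connect T v e s x y : is_graph_cycle ends T ((v, e) :: s) ->
  joins ends e x y -> connect (adj (T :\ e)) x y.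
Proof.
case/and5P => _ /= _ /andP [es us] /andP [eT sT] cyc jxy.
(* [w] follows [v] on the cycle, and is [v] itself when [e] is a loop. The rest of the cycle leads
   from [w] back to [v] without [e]. *)
pose w := (head (v, e) s).1.
suff vw : connect (adj (T :\ e)) w v /\ joins ends e v w.
  case: vw => cwv /orP [] /eqP E1; move: jxy; rewrite /joins E1 => /orP [] /eqP [].
  - by move=> <- <-; rewrite adj_sym.
  - by move=> <- <-.
  - by move=> <- <-.
  - by move=> <- <-; rewrite adj_sym.
move: cyc; rewrite {}/w.
case: s es us sT => [|[w f] s] /=; first by rewrite andbT; split.
move=> es us sT /andP [jv pth]; split => //.
elim: s w f es us sT pth {jv} => [|[w' f'] s IHs] w f /=.
  rewrite inE => /negbTE nef _ /andP [fT _] /andP [jf _].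
  apply: connect1; apply/existsP; exists f.
  by rewrite !inE eq_sym nef fT.
rewrite !inE !negb_or => /and3P [ef ef' es] /andP [_ us] /and3P [fT f'T sT].
case/andP => jf pth.
apply: connect_trans (IHs w' f' _ us _ pth).
- apply: connect1; apply/existsP; exists f.
  by rewrite !inE eq_sym ef fT.
- by rewrite inE negb_or ef'.
- by rewrite f'T.
Qed.

(** A minimal connected subset is acyclic: an edge on a cycle could be dropped, its ends being
    joined by the rest of the cycle. *)
Lemma connected_spanning_tree F : graph_connected ends F ->
  exists2 T : {set E}, T \subset F & is_spanning_tree ends T.
Proof.
move=> conF.
pose con (T : {set E}) := [forall u, forall v, connect (adj T) u v].
have [T minT sTF] : {T | minset con T & T \subset F}.
  by apply: minset_exists; apply/forallP => u; apply/forallP => v; apply: conF.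
exists T => //; have [cT minT'] := minsetP minT.
split=> [u v|]; first by have /forallP /(_ u) /forallP /(_ v) := cT.
case=> [|[v e] s] //; apply/negP => cyc.
have eT : e \in T by case/and5P: cyc => _ _ _ /= /andP [].
suff /minT' : con (T :\ e) by move=> /(_ (subD1set _ _)) E1; move: eT; rewrite -E1 !inE eqxx.
apply/forallP => x; apply/forallP => y.
have /forallP /(_ x) /forallP /(_ y) := cT.
apply: connect_sub => {}x {}y /existsP [f /andP [fT j]].
case: (f =P e) => [fe|/eqP fe].
  by apply: cycle_edge_connect cyc _; rewrite -fe.
by apply: connect1; apply/existsP; exists f; rewrite !inE fe fT.
Qed.

(* The defect form of Rado's condition for a transversal of the colour classes
   of [F] of size [#|V| - 1] that is independent in the graphic matroid. *)
Definition rado F :=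
  forall J, (#|J| + #|V| <= grank (F :&: col @^-1: J) + #|C| + 1)%N.

(** Suppose both deletions violate the condition, at [J] and at [L]. Both sets contain the common
    colour, and submodularity contradicts the condition for [F] at [J :|: L] and at [J :&: L]
    without that colour. *)
Lemma rado_delete F x y : rado F -> x \in F -> y \in F -> x != y ->
  col x = col y -> rado (F :\ x) \/ rado (F :\ y).
Proof.
move=> radoF xF yF xy cxy.
pose radob (G : {set E}) := [forall J : {set C},
  #|J| + #|V| <= grank (G :&: col @^-1: J) + #|C| + 1]%N.
have radobP G : reflect (rado G) (radob G) by apply: forallP.
suff : radob (F :\ x) || radob (F :\ y).
  by case/orP => /radobP; [left|right].
apply/negPn/negP; rewrite negb_or => /andP [].
case/forallPn => /= J; rewrite -ltnNge => ltJ /forallPn [/= L].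
rewrite -ltnNge => ltL.
have mem_col z (K : {set C}) : z \in F -> col z \notin K -> ~~ (#|K| + #|V| >
    grank ((F :\ z) :&: col @^-1: K) + #|C| + 1)%N.
  move=> zF ncz; rewrite -leqNgt; apply: leq_trans (radoF K) _.
  rewrite !leq_add2r; apply/grankS/subsetP => e; rewrite !inE => /andP [-> eK].
  by rewrite eK !andbT; apply: contraNneq ncz => <-.
have cJ : col x \in J by apply: contraTT ltJ => /mem_col ->.
have cL : col y \in L by apply: contraTT ltL => /mem_col ->.
(* The colour shared by [x] and [y] lies in [J] and in [L], so each deleted edge is supplied by the
   other set. *)
have sU : (grank (F :&: col @^-1: (J :|: L)) <=
    grank ((F :\ x) :&: col @^-1: J :|: (F :\ y) :&: col @^-1: L))%N.
  apply/grankS/subsetP => e; rewrite !inE => /andP [-> /=].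
  case: (e =P x) => [->|_] /=; last by case: (e =P y) => [->|_] //=; rewrite -cxy cJ.
  by rewrite xy cxy cL.
have sI : (grank (F :&: col @^-1: (J :&: L :\ col x)) <=
    grank (((F :\ x) :&: col @^-1: J) :&: ((F :\ y) :&: col @^-1: L)))%N.
  apply/grankS/subsetP => e; rewrite !inE => /and4P [-> nex -> ->] /=.
  rewrite !andbT; apply/andP; split.
    by apply: contraNneq nex => ->.
  by apply: contraNneq nex => ->; rewrite cxy.
have := radoF (J :|: L); have := radoF (J :&: L :\ col x).
have := grank_submod ((F :\ x) :&: col @^-1: J) ((F :\ y) :&: col @^-1: L).
have := cardsUI J L.
have := cardsD1 (col x) (J :&: L); rewrite inE cJ cxy cL /=.
rewrite cxy in sI *.
move: ltJ ltL sU sI; lia.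
Qed.

(** Deleting one of two edges of equal colour, as long as there are any, ends with a rainbow set.
    The condition at the set of all colours then gives rank at least [#|V| - 1]. *)
Lemma rado_rainbow_connected F : rado F ->
  exists2 G : {set E}, graph_connected ends G & rainbow col G.
Proof.
have [m] := ubnP #|F|; elim: m F => // m IHm F cF radoF.
case: (boolP [forall x in F, forall y in F, (col x == col y) ==> (x == y)]).
  move=> /forall_inP inj; exists F.
    apply: grank_connected.
    have := radoF setT; rewrite preimsetT setIT cardsT; lia.
  by move=> x y /inj /forall_inP /[apply] /implyP inj' /eqP /inj' /eqP.
case/forall_inPn => x xF /forall_inPn [y yF].
rewrite negb_imply => /andP [/eqP cxy xy].
have smaller z : z \in F -> (#|F :\ z| < m)%N.
  by move=> zF; move: cF; rewrite (cardsD1 z) zF.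
by case: (rado_delete radoF xF yF xy cxy); apply: IHm; apply: smaller.
Qed.

(** To get Rado's inequality at [J], take for [P] the components of the edges with colours in [J]:
    the edges crossing [P] have colours outside [J]. *)
Theorem rainbow_spanning_tree_criterion :
  (forall P, partition P [set: V] -> (2 <= #|P|)%N ->
     (#|P| <= #|col @: crossing P|.+1)%N) ->
  has_rainbow_spanning_tree ends col.
Proof.
move=> critP.
suff /rado_rainbow_connected [G conG rainG] : rado [set: E].
  have [T sTG treeT] := connected_spanning_tree conG.
  exists T => //; exact: sub_in2 (subsetP sTG) _ rainG.
move=> J; rewrite setTI; set F := col @^-1: J.
pose P : {set {set V}} := equivalence_partition (connect (adj F)) [set: V].
have eqR : {in [set: V] & &, equivalence_rel (connect (adj F))}.
  move=> x y z _ _ _; split=> [|xy]; first exact: connect0.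
  by apply: same_connect => //; apply: adj_sym.
have partP : partition P [set: V] by apply: equivalence_partitionP.
have memP x y : (y \in pblock P x) = connect (adj F) x y.
  by apply: pblock_equivalence_partition; rewrite ?inE.
have conP x y : pblock P x = pblock P y -> connect (adj F) x y.
  by rewrite -memP => ->; rewrite memP connect0.
have := card_leq_grank partP conP.
have sJ : col @: crossing P \subset ~: J.
  apply/subsetP => c /imsetP [e]; rewrite inE => ne ->.
  have [_ triP _] := and3P partP.
  rewrite inE; apply: contra ne => ceJ; apply/eqP/(same_pblock triP).
  rewrite memP; apply: connect1; apply/existsP; exists e.
  by rewrite [e \in F]inE ceJ joins_sym /joins -surjective_pairing eqxx.
have := subset_leq_card sJ; have := cardsC J.
(* With at most one component, [#|J| <= #|C|] suffices. *)
case: (leqP 2 #|P|) => [/(critP _ partP)|]; first lia.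
have := max_card [in J]; lia.
Qed.

End RainbowTree.

(** * Random edge sets carrying few colours *)

Lemma exists_set_between (T : finType) (X Z : {set T}) t :
  X \subset Z -> #|X| <= t <= #|Z| ->
  exists S : {set T}, [/\ X \subset S, S \subset Z & #|S| = t].
Proof.
move=> sXZ /andP [leXt letZ].
elim: t letZ leXt => [|t IHt] letZ leXt.
  by exists X; split=> //; apply/eqP; rewrite -leqn0.
case: (ltngtP #|X| t.+1) leXt => // [ltX _|eX _]; last by exists X.
have [S [sXS sSZ cS]] := IHt (ltnW letZ) ltX.
have : (0 < #|Z :\: S|) by rewrite cardsD (setIidPr sSZ) cS subn_gt0.
case/card_gt0P => z; rewrite inE => /andP [zS zZ].
exists (z |: S); rewrite cardsU1 zS cS; split => //.
  by apply: subset_trans sXS _; apply: subsetU1.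
by rewrite subUset sub1set zZ.
Qed.

Lemma exists_set_injection (T : finType) (A B : {set T}) : #|A| <= #|B| ->
  exists2 h : T -> T, {in A, forall x, h x \in B} & {in A &, injective h}.
Proof.
case: (pickP [in B]) => [b _ leAB|B0].
  have inA x : x \in A -> index x (enum A) < size (enum B).
    move=> xA; rewrite -cardE; apply: leq_trans leAB.
    by rewrite cardE index_mem mem_enum.
  exists (fun x => nth b (enum B) (index x (enum A))) => [x xA|x y xA yA].
    by rewrite -mem_enum mem_nth ?inA.
  move/eqP; rewrite nth_uniq ?inA ?enum_uniq // => /eqP eI.
  by rewrite -(nth_index x (s := enum A) (x := x)) ?mem_enum // eI nth_index ?mem_enum.
rewrite (eq_card0 B0) leqn0 cards_eq0 => /eqP ->.
by exists id => x; rewrite inE.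
Qed.

Section FewHits.
Variables (W C : finType).
Implicit Types (f : W -> option C) (Y : {set W}).

(** Colourings are partial: an element of colour [None] hits nothing. *)
Definition hits f Y : {set C} := [set c | [exists y in Y, f y == Some c]].

Definition few_hits f e t : {set {set W}} :=
  [set Y : {set W} | (#|Y| == e) && (#|hits f Y| <= t)].

Definition fibre f c : {set W} := [set y | f y == Some c].

Definition recolour f s b : W -> option C :=
  fun y => if y == s then Some b else f y.

Lemma hitsP f Y c : reflect (exists2 y, y \in Y & f y = Some c) (c \in hits f Y).
Proof. by rewrite inE; apply: (iffP exists_inP) => [] [y yY /eqP]; exists y => //; apply/eqP. Qed.

(* Inject the sets that are only good for [f] into those only good for the new
   colouring: they meet the class of [a] and miss that of [b], and swapping their
   elements of colour [a] other than [s] into class [b] repairs them. *)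
Lemma leq_few_hits_recolour f s a b e t : f s = Some a -> a != b ->
  #|fibre f a| <= #|fibre f b| ->
  #|few_hits f e t| <= #|few_hits (recolour f s b) e t|.
Proof.
move=> fs ab leab; set g := recolour f s b.
have sA : s \in fibre f a by rewrite inE fs.
have gs : g s = Some b by rewrite /g /recolour eqxx.
have gE y : y != s -> g y = f y by rewrite /g /recolour => /negbTE ->.
have [|h hB hI] := @exists_set_injection _ (fibre f a :\ s) (fibre f b).
  by apply: leq_trans leab; rewrite (cardsD1 s (fibre f a)) leq_addl.
pose swap x := if x \in fibre f a :\ s then h x else x.
set D := few_hits f e t :\: few_hits g e t.
set D' := few_hits g e t :\: few_hits f e t.
suff le : #|D| <= #|D'|.
  rewrite -(cardsID (few_hits g e t) (few_hits f e t)).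
  by rewrite -(cardsID (few_hits f e t) (few_hits g e t)) setIC leq_add2l.
have swap_inj : {in ~: fibre f b &, injective swap}.
  move=> x y; rewrite 2!in_setC /swap => xB yB.
  case: ifP => xA; case: ifP => yA //; first exact: hI.
    by move=> E; move: yB; rewrite -E hB.
  by move=> E; move: xB; rewrite E hB.
have memD Y : Y \in D -> [/\ #|Y| = e, #|hits f Y| <= t & t < #|hits g Y|].
  rewrite !inE => /andP [nY /andP [/eqP eY le]]; split => //.
  by move: nY; rewrite eY eqxx /= -ltnNge.
have sgf Y : hits g Y \subset b |: hits f Y.
  apply/subsetP => c /hitsP [y yY]; rewrite /g /recolour; case: eqP => [_ [<-]|_ fy].
    by rewrite !inE eqxx.
  by rewrite in_setU; apply/orP; right; apply/hitsP; exists y.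
(* If [Y] met class [b], moving [s] into that class would add no colour to [Y]. *)
have memDB Y : Y \in D -> Y \subset ~: fibre f b.
  move=> /memD [_ le lt]; apply/subsetP => y yY; rewrite in_setC.
  apply: contraL lt => yb; rewrite -leqNgt; apply: leq_trans le.
  apply: subset_leq_card; apply: subset_trans (sgf Y) _.
  rewrite subUset subxx andbT sub1set; apply/hitsP; exists y => //.
  by move: yb; rewrite inE => /eqP.
have memDs Y : Y \in D -> s \in Y.
  move=> /memD [_ le lt]; apply: contraLR lt => nsY; rewrite -leqNgt.
  apply: leq_trans le; apply: subset_leq_card.
  apply/subsetP => c /hitsP [y yY]; rewrite gE => [fy|].
    by apply/hitsP; exists y.
  by apply: contraNneq nsY => <-.
(* Were [s] the only element of [Y] of colour [a], recolouring would trade [a] for [b] and not raise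
   the count. *)
have memDA Y : Y \in D -> exists2 x, x \in Y & x \in fibre f a :\ s.
  move=> YD; have [_ le lt] := memD _ YD; have sY := memDs _ YD.
  case: (pickP [in Y :&: (fibre f a :\ s)]) => [x|noA].
    by rewrite /= in_setI => /andP []; exists x.
  move: lt; rewrite ltnNge => /negP []; apply: leq_trans le.
  have aY : a \in hits f Y by apply/hitsP; exists s.
  rewrite (cardsD1 a (hits f Y)) aY -[nat_of_bool true]/1%N -(cards1 b).
  apply: leq_trans (leq_card_setU _ _).
  apply: subset_leq_card; apply/subsetP => c /hitsP [y yY].
  have := noA y; rewrite in_setI yY /= in_setD1 => /negbT.
  rewrite negb_and negbK => /orP [/eqP -> | nya].
    by rewrite gs => [[<-]]; rewrite !inE eqxx.
  rewrite gE; last by apply: contraNneq nya => ->.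
  move=> fy; rewrite in_setU in_setD1; apply/orP; right; apply/andP; split.
    by apply: contraNneq nya => <-; rewrite inE fy.
  by apply/hitsP; exists y.
rewrite -(card_in_imset (f := fun Y => swap @: Y) (D := D)); last first.
  move=> Y1 Y2 /memDB /subsetP s1 /memDB /subsetP s2 E.
  apply/setP => x; apply/idP/idP => xY.
    have : swap x \in swap @: Y2 by rewrite -E imset_f.
    by case/imsetP => y yY /swap_inj -> //; [apply: s1 | apply: s2].
  have : swap x \in swap @: Y1 by rewrite E imset_f.
  by case/imsetP => y yY /swap_inj -> //; [apply: s2 | apply: s1].
apply: subset_leq_card; apply/subsetP => Z /imsetP [Y YD ->{Z}].
have [eY le lt] := memD _ YD; have sY := memDs _ YD.
have swaps : swap s = s by rewrite /swap !inE eqxx.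
have aY : a \in hits f Y by apply/hitsP; exists s.
have cY : #|swap @: Y| = e.
  rewrite card_in_imset // => x y xY yY.
  by apply: swap_inj; apply: (subsetP (memDB _ YD)).
(* Under [f] the swapped set still shows [a] through [s] and now also [b], hence all of
   [hits g Y]. *)
rewrite in_setD !inE cY eqxx /= -ltnNge; apply/andP; split.
  apply: leq_trans lt _; apply: subset_leq_card.
  apply: subset_trans (sgf Y) _; rewrite subUset sub1set; apply/andP; split.
    have [x xY xA] := memDA _ YD; apply/hitsP; exists (swap x); first exact: imset_f.
    by have := hB _ xA; rewrite /swap xA inE => /eqP.
  apply/subsetP => c /hitsP [y yY fy]; apply/hitsP.
  case: (boolP (y \in fibre f a :\ s)) => [yA|nyA].
    exists s; first by rewrite -swaps imset_f.
    by move: yA; rewrite !inE fy fs => /andP [_ /eqP].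
  by exists y => //; apply/imsetP; exists y => //; rewrite /swap (negbTE nyA).
(* Under [g] the swapped set has lost colour [a], so it shows at most [hits f Y] with [a] replaced
   by [b]. *)
apply: leq_trans le; rewrite (cardsD1 a (hits f Y)) aY -[nat_of_bool true]/1%N -(cards1 b).
apply: leq_trans (leq_card_setU _ _).
apply: subset_leq_card; apply/subsetP => c /hitsP [z /imsetP [y yY ->{z}]].
rewrite /swap; case: (boolP (y \in fibre f a :\ s)) => [yA|].
  have := hB _ yA; rewrite inE => /eqP fh; rewrite gE ?fh => [[<-]|].
    by rewrite !inE eqxx.
  by apply: contraNneq ab => hs; move: fh; rewrite hs fs => [[->]].
rewrite in_setD1 negb_and negbK => /orP [/eqP ->|nya].
  by rewrite gs => [[<-]]; rewrite !inE eqxx.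
rewrite gE; last by apply: contraNneq nya => ->.
move=> fy; rewrite in_setU in_setD1; apply/orP; right; apply/andP; split.
  by apply: contraNneq nya => <-; rewrite inE fy.
by apply/hitsP; exists y.
Qed.

Lemma card_fibre_recolour f s a b : f s = Some a -> a != b ->
  [/\ #|fibre f a| = #|fibre (recolour f s b) a|.+1,
      #|fibre (recolour f s b) b| = #|fibre f b|.+1 &
      forall c, c != a -> c != b -> #|fibre (recolour f s b) c| = #|fibre f c|].
Proof.
move=> fs ab; split=> [||c ca cb].
- rewrite (cardsD1 s) inE fs eqxx add1n; congr _.+1.
  apply: eq_card => y; rewrite !inE /recolour; case: eqP => //= _.
  by apply/esym/eqP => [[E]]; rewrite E eqxx in ab.
- rewrite (cardsD1 s) inE /recolour eqxx eqxx add1n; congr _.+1.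
  apply: eq_card => y; rewrite !inE /recolour; case: (y =P s) => [->|] //=.
  by rewrite fs; apply/esym/eqP => [[E]]; rewrite E eqxx in ab.
apply: eq_card => y; rewrite !inE /recolour; case: (y =P s) => [->|] //=.
rewrite fs; apply: (@etrans _ _ false); first by apply/eqP => [[E]]; rewrite E eqxx in cb.
by apply/esym/eqP => [[E]]; rewrite E eqxx in ca.
Qed.

(** While some class size lies strictly between [0] and [k], take two such classes and move an
    element from the smaller to the larger. The concave potential [defect] decreases at each
    move. *)
Lemma concentrate_fibres f k m :
  (forall c, #|fibre f c| <= k) -> \sum_c #|fibre f c| = k * m ->
  exists g, [/\ forall c, #|fibre g c| = 0 \/ #|fibre g c| = k,
    \sum_c #|fibre g c| = k * m &
    forall e t, #|few_hits f e t| <= #|few_hits g e t|].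
Proof.
pose defect g := \sum_c #|fibre g c| * (k - #|fibre g c|).
have [N] := ubnP (defect f); elim: N f => // N IHN f ltN lek sumf.
pose mid := [pred c | (0 < #|fibre f c|) && (#|fibre f c| < k)].
have nmid c : ~~ mid c -> #|fibre f c| = 0 \/ #|fibre f c| = k.
  by rewrite /= negb_and -leqNgt -leqNgt; have := lek c; lia.
case: (pickP mid) => [a mida|nomid]; last first.
  by exists f; split => // c; apply/nmid/negbT.
(* If all other classes had size [0] or [k], the size of class [a] would be a multiple of [k], as
   the total is. *)
have [b midb ba] : exists2 b, mid b & b != a.
  case: (pickP [pred c | mid c && (c != a)]) => [b /andP []|nob]; first by exists b.
  have kdvd : k %| \sum_(c | c != a) #|fibre f c|.
    apply: dvdn_sum => c ca; have := nob c; rewrite /= ca andbT => /negbT.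
    by case/nmid => ->.
  have := sumf; rewrite (bigD1 a) //= => E.
  have : k %| #|fibre f a| by rewrite -(dvdn_addl _ kdvd) E dvdn_mulr.
  by move/(dvdn_leq (proj1 (andP mida))); case/andP: mida; lia.
wlog le : a b mida midb ba / #|fibre f a| <= #|fibre f b|.
  move=> wl; case: (leqP #|fibre f a| #|fibre f b|) => [|/ltnW]; first exact: wl.
  by apply: wl => //; rewrite eq_sym.
have [s sa] : exists s, s \in fibre f a by apply/card_gt0P; case/andP: mida.
have fs : f s = Some a by apply/eqP; move: sa; rewrite inE.
have ab : a != b by rewrite eq_sym.
have [ca cb cc] := card_fibre_recolour fs ab; set g := recolour f s b in ca cb cc.
have splitE (F : C -> nat) :
    \sum_c F c = F a + (F b + \sum_(c | (c != a) && (c != b)) F c).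
  by rewrite (bigD1 a) //= (bigD1 b).
have E1 : \sum_(c | (c != a) && (c != b)) #|fibre g c| =
          \sum_(c | (c != a) && (c != b)) #|fibre f c|.
  by apply: eq_bigr => c /andP [? ?]; rewrite cc.
have E2 : \sum_(c | (c != a) && (c != b)) #|fibre g c| * (k - #|fibre g c|) =
          \sum_(c | (c != a) && (c != b)) #|fibre f c| * (k - #|fibre f c|).
  by apply: eq_bigr => c /andP [? ?]; rewrite cc.
have [|c||h [h1 h2 h3]] := IHN g.
- rewrite ltnS in ltN; apply: leq_trans ltN; rewrite /defect !splitE E2 !addnA -addSn leq_add2r.
  (* The sizes change from [x + 1] and [y] to [x] and [y + 1], and the defect drops by
     [2 * (y - x)]. *)
  move: mida midb le; rewrite /= cb ca; move: #|fibre g a| #|fibre f b| => x y.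
  case/andP => _ ltx /andP [_ lty] lexy.
  have {ltx}[u ku] : exists u, k = x + 1 + u.+1 by exists (k - x.+2); lia.
  have {lty}[v kv] : exists v, k = y + v.+1 by exists (k - y.+1); lia.
  have -> : k - x = u.+2 by lia.
  have -> : k - x.+1 = u.+1 by lia.
  have -> : k - y = v.+1 by lia.
  have -> : k - y.+1 = v by lia.
  have : u = y + v - x - 1 by lia.
  nia.
- case: (c =P a) => [->|/eqP nca]; first by have := lek a; lia.
  case: (c =P b) => [->|/eqP ncb]; first by case/andP: midb; rewrite cb.
  by rewrite cc.
- by rewrite splitE E1 -sumf splitE cb ca; lia.
exists h; split => // e t.
exact: leq_trans (leq_few_hits_recolour e t fs ab le) (h3 e t).
Qed.

(** The colours hit by [Y] extend to exactly [t] of the [m] full classes, and [Y] lies in the union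
    of these classes and the [r] uncoloured elements. *)
Lemma card_few_hits f k m r e t : 0 < k -> t <= m ->
  (forall c, #|fibre f c| = 0 \/ #|fibre f c| = k) ->
  \sum_c #|fibre f c| = k * m -> #|W| = k * m + r ->
  #|few_hits f e t| <= 'C(m, t) * 'C(k * t + r, e).
Proof.
move=> k0 ltm fib sumf cW.
pose U := [set c | 0 < #|fibre f c|].
have fibU c : c \in U -> #|fibre f c| = k by rewrite inE; case: (fib c) => ->.
have sumU (S : {set C}) : S \subset U -> \sum_(c in S) #|fibre f c| = k * #|S|.
  move=> /subsetP sSU; rewrite mulnC -sum_nat_const.
  by apply: eq_bigr => c /sSU /fibU.
have cU : #|U| = m.
  apply/eqP; rewrite -(eqn_pmul2l k0) -sumU // -sumf; apply/eqP.
  rewrite [RHS](bigID [in U]) /= [X in _ + X]big1 ?addn0 // => c.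
  by rewrite inE -leqNgt leqn0 => /eqP.
have cNone : #|[set y | f y == None]| = r.
  have : #|W| = #|[set y | f y == None]| + \sum_c #|fibre f c|.
    rewrite -[LHS]sum1_card (bigID (fun y => f y == None)) /=; congr (_ + _).
      by rewrite -[RHS]sum1_card; apply: eq_bigl => y; rewrite !inE.
    rewrite (eq_bigr (fun y => \sum_c (f y == Some c : nat))); last first.
      move=> y; case fy: (f y) => [c|] // _.
      by rewrite (bigD1 c) //= eqxx big1 // => d dc; case: eqP => // [[E]]; rewrite E eqxx in dc.
    rewrite exchange_big; apply: eq_bigr => c _; rewrite -sum1dep_card.
    rewrite big_mkcond [RHS]big_mkcond; apply: eq_bigr => y _ /=.
    by case: (f y) => [d|] //=; case: eqP.
  by rewrite sumf cW; lia.
pose slots (S : {set C}) := [set y | if f y is Some c then c \in S else true].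
have cslots (S : {set C}) : S \subset U -> #|slots S| = k * #|S| + r.
  move=> /sumU <-; rewrite -cNone addnC -[LHS]sum1_card (bigID (fun y => f y == None)) /=.
  congr (_ + _).
    rewrite -[RHS]sum1_card; apply: eq_bigl => y.
    by rewrite !inE; case: (f y) => [d|] //=; rewrite andbF.
  rewrite (eq_bigr (fun y => \sum_(c in S) (f y == Some c : nat))); last first.
    move=> y /andP []; rewrite inE; case fy: (f y) => [c|] // cS _.
    rewrite (bigD1 c) //= eqxx big1 // => d /andP [_ dc].
    by case: eqP => // [[E]]; rewrite E eqxx in dc.
  rewrite exchange_big; apply: eq_bigr => c cS; rewrite -sum1dep_card.
  rewrite big_mkcond [RHS]big_mkcond; apply: eq_bigr => y _ /=.
  rewrite inE; case: (f y) => [d|] //=; case: eqP => [[->]|_] //=; first by rewrite cS.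
  by case: ifP.
pose drawn (S : {set C}) := [set Y : {set W} | Y \subset slots S & #|Y| == e].
pose SS := [set S : {set C} | S \subset U & #|S| == t].
have cover_few : few_hits f e t \subset \bigcup_(S in SS) drawn S.
  apply/subsetP => Y; rewrite inE => /andP [eY le].
  have sU : hits f Y \subset U.
    apply/subsetP => c /hitsP [y _ fy]; rewrite inE; apply/card_gt0P; exists y.
    by rewrite inE fy.
  have [|S [s1 s2 s3]] := exists_set_between (t := t) sU; first by rewrite le cU.
  apply/bigcupP; exists S; first by rewrite inE s2 s3 eqxx.
  rewrite inE eY andbT; apply/subsetP => y yY; rewrite inE.
  by case fy: (f y) => [c|] //; apply: (subsetP s1); apply/hitsP; exists y.
apply: leq_trans (subset_leq_card cover_few) _.
apply: (@leq_trans (\sum_(S in SS) #|drawn S|)).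
  elim/big_rec2: _ => [|S B A _ le]; first by rewrite cards0.
  by apply: leq_trans (leq_card_setU _ _) _; rewrite leq_add2l.
rewrite (eq_bigr (fun=> 'C(k * t + r, e))) => [|S].
  by rewrite sum_nat_const cards_draws cU.
by rewrite inE => /andP [sSU /eqP cS]; rewrite cards_draws cslots // cS.
Qed.

(** Erasing colours only lowers the number of hits. So the classes are cut down to at most [k]
    elements each and [k * m] in all, and then concentrated into [m] full classes. *)
Theorem card_few_colours (col : W -> C) k m e t : 0 < k -> t <= m ->
  k * m <= \sum_c minn k #|col @^-1: [set c]| ->
  #|[set Y : {set W} | (#|Y| == e) && (#|col @: Y| <= t)]| <=
    'C(m, t) * 'C(k * t + (#|W| - k * m), e).
Proof.
move=> k0 tm lesum.
have ex c : exists S : {set W}, S \subset col @^-1: [set c] /\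
    #|S| = minn k #|col @^-1: [set c]|.
  have [|S [_ s2 s3]] := @exists_set_between W set0 (col @^-1: [set c])
    (minn k #|col @^-1: [set c]|) (sub0set _); first by rewrite cards0 geq_minr.
  by exists S.
have [B] := fin_all_exists ex; move=> HB.
pose U := [set y | y \in B (col y)].
have UB c : U :&: col @^-1: [set c] = B c.
  apply/setP => y; rewrite !inE; case: (HB c) => /subsetP sB _.
  apply/andP/idP => [[yB /eqP <-] //|yB].
  by have := sB _ yB; rewrite !inE => /eqP E; rewrite E eqxx.
have sum_col (S : {set W}) : \sum_c #|S :&: col @^-1: [set c]| = #|S|.
  rewrite -[RHS]sum1_card (partition_big col xpredT) //=; apply: eq_bigr => c _.
  by rewrite -sum1_card; apply: eq_bigl => y; rewrite !inE.
have leU : k * m <= #|U|.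
  rewrite -sum_col; apply: leq_trans lesum _; apply: leq_sum => c _.
  by rewrite UB; case: (HB c) => _ ->.
have [|U' [_ sU' cU']] := @exists_set_between W set0 U (k * m) (sub0set _).
  by rewrite cards0.
pose f y := if y \in U' then Some (col y) else None.
have fibf c : fibre f c = U' :&: col @^-1: [set c].
  apply/setP => y; rewrite !inE /f; by case: ifP.
have lek c : #|fibre f c| <= k.
  rewrite fibf; apply: leq_trans (geq_minl k #|col @^-1: [set c]|).
  case: (HB c) => _ <-; rewrite -UB; exact/subset_leq_card/setSI.
have sumf : \sum_c #|fibre f c| = k * m.
  by rewrite -cU' -sum_col; apply: eq_bigr => c _; rewrite fibf.
have [g [g1 g2 g3]] := concentrate_fibres lek sumf.
have kmW : k * m <= #|W| by rewrite -cU' max_card.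
apply: (@leq_trans #|few_hits f e t|).
  apply/subset_leq_card/subsetP => Y; rewrite !inE => /andP [-> le] /=.
  apply: leq_trans le; apply/subset_leq_card/subsetP => c /hitsP [y yY].
  by rewrite /f; case: ifP => // _ [<-]; apply: imset_f.
apply: leq_trans (g3 e t) _; apply: card_few_hits => //.
by rewrite subnKC.
Qed.

End FewHits.

Local Open Scope ring_scope.

(** * Uniform bijections and uniform neighbour sets *)

Section UniformBijection.
Variables (R : realType) (A B : finType).
Hypothesis cardAB : #|A| = #|B|.

Lemma bijections_injective (b : {ffun A -> B}) :
  reflect (injective b) (b \in bijections A B).
Proof.
rewrite inE; apply: (iffP (asboolP _)) => [/bij_inj //|inj].
by apply: inj_card_bij inj _; rewrite cardAB.
Qed.

Lemma card_bijections_gt0 : (0 < #|bijections A B|)%N.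
Proof.
apply/card_gt0P; exists [ffun x => enum_val (cast_ord cardAB (enum_rank x))].
apply/bijections_injective => x y; rewrite !ffunE.
by move/enum_val_inj/cast_ord_inj/enum_rank_inj.
Qed.

Let carrying (X : {set A}) (Y : {set B}) :=
  [set b in bijections A B | [set b x | x in X] == Y].

(** Composition with a permutation of [B] taking [Y] to [Y'] injects one family into the other. *)
Let card_carrying_le X (Y Y' : {set B}) : #|Y| = #|Y'| ->
  (#|carrying X Y| <= #|carrying X Y'|)%N.
Proof.
move=> cY.
have [|h1 h1Y h1I] := @exists_set_injection _ Y Y'; first by rewrite cY.
have [|h2 h2Y h2I] := @exists_set_injection _ (~: Y) (~: Y').
  by have := cardsC Y; have := cardsC Y'; rewrite cY; lia.
pose h x := if x \in Y then h1 x else h2 x.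
have hI : injective h.
  move=> x y; rewrite /h; case: ifPn => xY; case: ifPn => yY; first exact: h1I.
  - move=> E; have := h2Y y; rewrite !inE -E => /(_ yY).
    by rewrite h1Y.
  - move=> E; have := h2Y x; rewrite !inE E => /(_ xY).
    by rewrite h1Y.
  by apply: h2I; rewrite inE.
have hY : h @: Y = Y'.
  apply/eqP; rewrite eqEcard card_imset // cY leqnn andbT.
  by apply/subsetP => _ /imsetP [y yY ->]; rewrite /h yY h1Y.
pose comp (b : {ffun A -> B}) := [ffun x => h (b x)] : {ffun A -> B}.
rewrite -(card_imset (f := comp)); last first.
  by move=> b b' /ffunP E; apply/ffunP => x; have := E x; rewrite !ffunE => /hI.
apply/subset_leq_card/subsetP => b' /imsetP [b]; rewrite inE => /andP [bij /eqP bX] ->.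
rewrite inE; apply/andP; split.
  by apply/bijections_injective => x y; rewrite !ffunE => /hI; apply/bijections_injective.
rewrite -hY -bX -imset_comp; apply/eqP/eq_imset => x.
by rewrite /= ffunE.
Qed.

Lemma sum_unif (T : finType) (D : {set T}) (p : pred T) :
  \sum_x unif R D x * (p x)%:R = #|[set x in D | p x]|%:R / #|D|%:R.
Proof.
rewrite /unif -[X in _ = X%:R / _]sum1_card natr_sum mulr_suml [RHS]big_mkcond /=.
apply: eq_bigr => x _; rewrite inE.
by case: (x \in D); case: (p x); rewrite /= ?mul0r ?mulr0 ?mulr1.
Qed.

(** Equally many bijections carry [X] to each set of its size, so the image of [X] is uniform among
    these sets. *)
Lemma sum_unif_bijections (X : {set A}) (G : pred {set B}) :
  \sum_b unif R (bijections A B) b * (G [set b x | x in X])%:R =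
  #|[set Y : {set B} | (#|Y| == #|X|) && G Y]|%:R / 'C(#|B|, #|X|)%:R.
Proof.
rewrite (sum_unif _ (fun b : {ffun A -> B} => G [set b x | x in X])).
have carryE (Y : {set B}) : #|Y| != #|X| -> #|carrying X Y| = 0%N.
  move=> ne; apply/eqP; rewrite cards_eq0; apply/eqP/setP => b; rewrite !inE.
  apply/negP => /andP [bij /eqP bX]; move: ne; rewrite -bX card_imset ?eqxx //.
  by apply/bijections_injective; rewrite inE.
have [Y0 cY0] : exists Y0 : {set B}, #|Y0| = #|X|.
  have [|Y0 [_ _ ?]] := @exists_set_between B set0 setT #|X| (sub0set _).
    by rewrite cards0 cardsT -cardAB max_card.
  by exists Y0.
have carryY (Y : {set B}) : #|Y| = #|X| -> #|carrying X Y| = #|carrying X Y0|.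
  by move=> cY; apply/eqP; rewrite eqn_leq !card_carrying_le // cY cY0.
have countE (p : pred {set B}) :
    #|[set b in bijections A B | p [set b x | x in X]]| =
    (#|[set Y : {set B} | (#|Y| == #|X|) && p Y]| * #|carrying X Y0|)%N.
  rewrite -sum_nat_const -[LHS]sum1_card.
  rewrite (partition_big (fun b : {ffun A -> B} => [set b x | x in X]) p) /=; last first.
    by move=> b; rewrite inE => /andP [].
  rewrite [LHS]big_mkcond [RHS]big_mkcond; apply: eq_bigr => Y _; rewrite inE.
  case pY: (p Y); rewrite ?andbF ?andbT //.
  transitivity #|carrying X Y|.
    rewrite -sum1_card; apply: eq_bigl => b; rewrite !inE.
    by case: eqP => [->|]; rewrite ?andbF // pY !andbT.
  by case: eqP => [/carryY|/eqP /carryE].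
have := countE G; have := countE xpredT.
have -> : [set b in bijections A B | true] = bijections A B.
  by apply/setP => b; rewrite !inE andbT.
have -> : #|[set Y : {set B} | (#|Y| == #|X|) && true]| = 'C(#|B|, #|X|).
  rewrite -[in RHS]cardsT -cards_draws.
  by apply: eq_card => Y; rewrite !inE andbT subsetT.
have := card_bijections_gt0 => + bE; rewrite bE muln_gt0 => /andP [c0 s0] ->.
by rewrite !natrM -mulf_div divff ?mulr1 // pnatr_eq0 -lt0n.
Qed.

End UniformBijection.

(** * Binomial estimates for a random neighbour set *)

Lemma mul_bin_bin e m N : (e <= m)%N -> (m <= N)%N ->
  ('C(N, m) * 'C(m, e) = 'C(N, e) * 'C(N - e, m - e))%N.
Proof.
move=> em mN; have eN := leq_trans em mN.
apply/eqP; rewrite -(eqn_pmul2r (fact_gt0 e)) -(eqn_pmul2r (fact_gt0 (m - e))).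
rewrite -(eqn_pmul2r (fact_gt0 (N - m))); apply/eqP.
have e1 := bin_fact em; have e2 := bin_fact mN; have e3 := bin_fact eN.
have : (m - e <= N - e)%N by lia.
move/bin_fact; have -> : (N - e - (m - e) = N - m)%N by lia.
move=> e4; transitivity (N`!)%N; first by rewrite -e2 -e1; ring.
by rewrite -e3 -e4; ring.
Qed.

Lemma card_draws_meet (T : finType) (X A : {set T}) k j : A \subset X ->
  (#|[set S : {set T} | [&& S \subset X, #|S| == k & #|S :&: A| == j]]| <=
    'C(#|A|, j) * 'C(#|X| - #|A|, k - j))%N.
Proof.
move=> sAX.
pose split (S : {set T}) := (S :&: A, S :\: A).
rewrite -(card_in_imset (f := split)); last first.
  by move=> S S' _ _ [E1 E2]; rewrite -(setID S A) E1 E2 setID.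
have -> : (#|X| - #|A|)%N = #|X :\: A| by rewrite cardsD (setIidPr sAX).
rewrite -!cards_draws -cardsX.
apply/subset_leq_card/subsetP => S' /imsetP [S]; rewrite inE => /and3P [sS /eqP cS cI] ->.
rewrite !inE /= subsetIr cI setSD //= cardsD cS.
by rewrite (eqP cI).
Qed.

(** Compare falling factorials factor by factor: [(a - i) / (N - i) <= a / N]. *)
Lemma bin_expn_le a N j : (a <= N)%N -> ('C(a, j) * N ^ j <= 'C(N, j) * a ^ j)%N.
Proof.
move=> leaN; rewrite -(leq_pmul2r (fact_gt0 j)).
rewrite mulnAC bin_ffact mulnAC bin_ffact.
elim: j => [|j IHj]; first by rewrite !ffactn0.
rewrite !ffactnSr !expnSr -!mulnA (mulnCA (a - j)%N) (mulnCA (N - j)%N) !mulnA -mulnA -[leqRHS]mulnA.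
apply: leq_mul => //; rewrite !mulnBl mulnC leq_sub2l //.
by rewrite leq_mul2l leaN orbT.
Qed.

(** Split by [j = #|S :&: A|]. Each part is at most ['C(#|X|, k) * 'C(k, j) * #|A| ^ j], and the
    binomial theorem sums these bounds. *)
Lemma sum_draws_meet (T : finType) (X A : {set T}) k : A \subset X ->
  (\sum_(S : {set T} | (S \subset X) && (#|S| == k)) #|X| ^ #|S :&: A| <=
    'C(#|X|, k) * #|A|.+1 ^ k)%N.
Proof.
move=> sAX; have leA := subset_leq_card sAX.
rewrite (partition_big (fun S : {set T} => inord #|S :&: A| : 'I_k.+1) xpredT) //=.
rewrite -(add1n #|A|) expnDn big_distrr /=; apply: leq_sum => j _.
have lejk : (j <= k)%N by rewrite -ltnS.
apply: (@leq_trans ('C(#|A|, j) * 'C(#|X| - #|A|, k - j) * #|X| ^ j)).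
  apply: (@leq_trans (\sum_(S in [set S : {set T} |
      [&& S \subset X, #|S| == k & #|S :&: A| == j]]) #|X| ^ j)).
    rewrite [leqLHS]big_mkcond [leqRHS]big_mkcond; apply: leq_sum => S _ /=.
    rewrite inE; case: (boolP (S \subset X)) => //= sS; case: eqP => //= cS.
    case: eqP => // E.
    have -> : #|S :&: A| = j by rewrite -E inordK // ltnS -cS subset_leq_card ?subsetIl.
    by rewrite eqxx.
  by rewrite sum_nat_const leq_mul2r card_draws_meet ?orbT.
rewrite exp1n mul1n.
have [ltaj|leja] := ltnP #|A| j; first by rewrite bin_small.
have [ltXk|lekX] := ltnP #|X| k.
  rewrite (@bin_small (_ - _)) ?muln0 //; lia.
rewrite mulnAC [leqRHS]mulnA (mulnC 'C(#|X|, k)).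
rewrite (mulnC 'C(k, j)) mul_bin_bin //.
rewrite [leqRHS]mulnAC leq_mul ?bin_expn_le //.
by apply: leq_bin2l; lia.
Qed.

Lemma subset_setC1 (T : finType) (S : {set T}) i : (S \subset [set~ i]) = (i \notin S).
Proof. by rewrite subsetC sub1set inE. Qed.

(** As [i] is never chosen, only [D :\ i] matters, whose size plus one is [#|D|]. Hence the mean of
    [n.-1 ^- #|S :\: D|] is at most [(#|D| / n.-1) ^ k]. *)
Lemma sum_neighbour_sets n k (i : 'I_n) (D : {set 'I_n}) : i \in D ->
  (\sum_(S in neighbour_sets k i) n.-1 ^ #|S :&: D| <= 'C(n.-1, k) * #|D| ^ k)%N.
Proof.
move=> iD.
have cX : #|[set~ i]| = n.-1 by rewrite cardsC1 card_ord.
have sDX : D :\ i \subset [set~ i] by apply/subsetP => x; rewrite !inE => /andP [].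
have := sum_draws_meet k sDX; rewrite cX (cardsD1 i D) iD; apply: leq_trans.
apply: eq_leq; apply: eq_big => [S|S].
  by rewrite inE andbC subset_setC1.
rewrite inE => /andP [_ iS]; congr (_ ^ _)%N; apply: eq_card => x; rewrite !inE.
by case: eqP => [->|]; rewrite //= ?andbF (negbTE iS).
Qed.

Lemma card_neighbour_sets n k (i : 'I_n) : #|neighbour_sets k i| = 'C(n.-1, k).
Proof.
have <- : #|[set~ i]| = n.-1 by rewrite cardsC1 card_ord.
by rewrite -cards_draws; apply: eq_card => S; rewrite !inE andbC subset_setC1.
Qed.

(** * Sums over set partitions *)

Lemma card_partition_le (T : finType) (P : {set {set T}}) (X : {set T}) :
  partition P X -> (#|P| <= #|X|)%N.
Proof.
move=> partP; rewrite (card_partition partP) -sum1_card.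
apply: leq_sum => A AP; rewrite card_gt0.
by have /and3P [_ _ P0] := partP; apply: contraNneq P0 => <-.
Qed.

Section PowerCoefficients.
Variable R : realFieldType.
Implicit Types d : nat -> R.

(* The coefficient of [x ^ r] in [(\sum_i d i * x ^ i) ^ K]. *)
Fixpoint pow_coef d (K r : nat) : R :=
  if K is K'.+1 then \sum_(i < r.+1) d i * pow_coef d K' (r - i)%N
  else (r == 0%N)%:R.

Lemma pow_coef_ge0 d K r : (forall i, 0 <= d i) -> 0 <= pow_coef d K r.
Proof.
move=> d0; elim: K r => [|K IHK] r /=; first exact: ler0n.
by apply: sumr_ge0 => i _; apply: mulr_ge0.
Qed.

(** The exponential formula as an inequality: [K!] orders the blocks, and a block of size [v] has
    exponential weight [w v / v!]. Blocks being nonempty, sizes are shifted by one, which leaves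
    total degree [#|X| - K]. The induction removes one block. *)
Lemma sum_partitions_le (T : finType) (w : nat -> R) K (X : {set T}) :
  (forall v, 0 <= w v) -> (K <= #|X|)%N ->
  K`!%:R * \sum_(P | partition P X && (#|P| == K)) \prod_(A in P) w #|A| <=
  #|X|`!%:R * pow_coef (fun i => w i.+1 / i.+1`!%:R) K (#|X| - K).
Proof.
move=> w0; set d := (fun i : nat => w i.+1 / i.+1`!%:R).
have d0 i : 0 <= d i by rewrite divr_ge0.
elim: K X => [|K IHK] X leKX.
  rewrite subn0 fact0 mul1r; case: (posnP #|X|) => [X0|X0].
    rewrite X0 /= mulr1 (bigD1 set0) /=; last first.
      rewrite cards0 eqxx andbT; move/eqP: X0; rewrite cards_eq0 => /eqP ->.
      by rewrite partition_set0.
    rewrite big_set0 big1 ?addr0 // => P /andP [/andP [_]].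
    by rewrite cards_eq0 => ->.
  rewrite big1 ?mulr_ge0 ?pow_coef_ge0 // => P /andP [partP].
  rewrite cards_eq0 => /eqP P0; move: X0; rewrite (card_partition partP) P0.
  by rewrite big_set0.
pose Z (L : nat) (Y : {set T}) := \sum_(P | partition P Y && (#|P| == L)) \prod_(A in P) w #|A|.
rewrite -/(Z _ _).
(* Each partition is counted once for each of its [K.+1] blocks, taken as the removed one. *)
have step : K.+1%:R * Z K.+1 X <=
    \sum_(A : {set T} | (A \subset X) && (A != set0)) w #|A| * Z K (X :\: A).
  rewrite /Z mulr_sumr.
  rewrite (eq_bigr (fun P : {set {set T}} => \sum_(A in P) (w #|A| *
      \prod_(B in P :\ A) w #|B|))); last first.
    move=> P /andP [_ /eqP cP].
    rewrite [RHS](eq_bigr (fun=> \prod_(A in P) w #|A|)) => [|A AP]; last first.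
      rewrite /= [RHS](bigD1 A) //=; congr (_ * _); apply: eq_bigl => B.
      by rewrite !inE andbC.
    by rewrite sumr_const cP mulr_natl.
  rewrite (exchange_big_dep (fun A : {set T} => (A \subset X) && (A != set0))) /=; last first.
    move=> P A /andP [partP _] AP; apply/andP; split.
      by rewrite -(cover_partition partP); apply: bigcup_sup.
    by have /and3P [_ _ P0] := partP; apply: contraNneq P0 => <-.
  apply: ler_sum => A /andP [sAX nA].
  rewrite -mulr_sumr ler_wpM2l //.
  rewrite (reindex_onto (fun P : {set {set T}} => A |: P) (fun P => P :\ A)) /=; last first.
    by move=> P /andP [_ AP]; rewrite setD1K.
  rewrite [leLHS]big_mkcond [leRHS]big_mkcond; apply: ler_sum => P _.
  case: ifP => [/andP [/andP [/andP [partP /eqP cP] AP] /eqP E]|_]; last first.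
    by case: ifP => // _; apply: prodr_ge0.
  have := partitionD1 partP AP; rewrite E => ->.
  have := cardsD1 A (A |: P); rewrite AP E cP => /eqP.
  by rewrite eqSS => /eqP <-; rewrite eqxx.
have ZE (A : {set T}) : A \subset X -> A != set0 ->
    K`!%:R * Z K (X :\: A) <=
    if (#|A| + K <= #|X|)%N then (#|X| - #|A|)`!%:R * pow_coef d K (#|X| - K - #|A|)
    else 0.
  move=> sAX _; have cXA : #|X :\: A| = (#|X| - #|A|)%N by rewrite cardsD (setIidPr sAX).
  have leA := subset_leq_card sAX.
  case: ifP => le.
    by have := IHK (X :\: A); rewrite cXA subnAC; apply; lia.
  rewrite /Z big1 ?mulr0 // => P /andP [/card_partition_le leP /eqP cP].
  by move: leP; rewrite cP cXA; lia.
rewrite factS mulnC natrM -mulrA.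
apply: le_trans (ler_wpM2l (ler0n _ _) step) _.
rewrite mulr_sumr.
(* The value is [0] when the removed block is too large to leave [K] nonempty blocks. *)
pose t (v : nat) : R := if (v + K <= #|X|)%N
  then w v * ((#|X| - v)`!%:R * pow_coef d K (#|X| - K - v)) else 0.
have t0 v : 0 <= t v.
  by rewrite /t; case: ifP => // _; rewrite !mulr_ge0 // pow_coef_ge0.
apply: (@le_trans _ _ (\sum_(A : {set T} | (A \subset X) && (A != set0)) t #|A|)).
  apply: ler_sum => A /andP [sAX nA].
  rewrite mulrCA; apply: le_trans (ler_wpM2l (w0 _) (ZE _ sAX nA)) _.
  by rewrite /t; case: ifP => // _; rewrite mulr0.
rewrite (bigID (fun A : {set T} => (#|A| + K <= #|X|)%N)) /= [X in _ + X]big1 ?addr0; last first.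
  by move=> A /andP [_ /negbTE lt]; rewrite /t lt.
(* The index is the size of the removed block minus one. *)
rewrite (partition_big (fun A : {set T} => inord #|A|.-1 : 'I_(#|X| - K.+1).+1) xpredT) //=.
rewrite mulr_sumr; apply: ler_sum => i _.
have lei : (i.+1 + K <= #|X|)%N by have := ltn_ord i; lia.
apply: (@le_trans _ _ (\sum_(A in [set A : {set T} | (A \subset X) & (#|A| == i.+1)]) t i.+1)).
  rewrite [leLHS]big_mkcond [leRHS]big_mkcond; apply: ler_sum => A _.
  rewrite inE; case: ifP => [/andP [/andP [/andP [sAX A0] leA] /eqP E]|_]; last first.
    by case: ifP => // _; apply: t0.
  rewrite -card_gt0 in A0; rewrite sAX /=.
  have E' : #|A| = i.+1.
    have := congr1 val E; rewrite /= inordK; first by lia.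
    by rewrite ltnS; lia.
  by rewrite E' eqxx.
rewrite sumr_const cards_draws -[leLHS]mulr_natl /t lei.
have -> : (#|X| - K - i.+1 = #|X| - K.+1 - i)%N by lia.
rewrite !mulrA ler_wpM2r ?pow_coef_ge0 //.
have le2 : (i.+1 <= #|X|)%N by lia.
rewrite -(bin_fact le2) /d; have := fact_gt0 i.+1.
move: (i.+1`!) => F F0; have nz : (F%:R : R) != 0 by rewrite pnatr_eq0 -lt0n.
rewrite !natrM le_eqVlt; apply/orP; left; apply/eqP; field.
exact: nz.
Qed.

End PowerCoefficients.

(** * Growth of convolution powers *)

Section PowCoefBound.
Variable R : realFieldType.
Implicit Types d : nat -> R.

Lemma pow_coef_r0 d K : d 0%N = 1 -> pow_coef d K 0 = 1.
Proof. by move=> d0; elim: K => //= K IHK; rewrite big_ord1 d0 mul1r subnn. Qed.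

(** Induction on [K]: the first term of the convolution is the previous bound, the inner terms cost
    a factor [eta] by hypothesis, and the last is explicit. The final factor [c K] satisfies
    [c (K + 1) = (1 + eta * y) * c K + y]. A smaller [y] buys slower growth in [K] for a factor
    [y ^- r.+1]. *)
Lemma pow_coef_le d (eta y : R) K r : d 0%N = 1 -> (forall i, 0 <= d i) ->
  0 < eta -> 0 < y <= 1 ->
  (forall r, \sum_(i < r) d i.+1 * d (r - i)%N <= eta * d r.+1) ->
  pow_coef d K r.+1 <= d r.+1 * y ^- r.+1 * (((1 + eta * y) ^+ K - 1) / eta).
Proof.
move=> d0 d_ge0 eta0 /andP [y0 y1] conv.
have y'1 : 1 <= y^-1 by rewrite invf_ge1.
elim: K r => [|K IHK] r; first by rewrite /= expr0 subrr mul0r mulr0.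
set u := (1 + eta * y) ^+ K in IHK *.
have u1 : 1 <= u by rewrite exprn_ege1 // lerDl mulr_ge0 // ltW.
rewrite [pow_coef _ _ _]/= big_ord_recl /= big_ord_recr /= d0 mul1r subn0.
rewrite /bump /= !add1n subnn pow_coef_r0 // mulr1.
have mid : \sum_(i < r) d i.+1 * pow_coef d K (r.+1 - i.+1)%N <=
    eta * d r.+1 * y ^- r * ((u - 1) / eta).
  apply: (@le_trans _ _ (\sum_(i < r) d i.+1 * d (r - i)%N * (y ^- r * ((u - 1) / eta)))).
    apply: ler_sum => i _; rewrite subSS -!mulrA ler_wpM2l //.
    have -> : (r - i = (r - i.+1).+1)%N by have := ltn_ord i; lia.
    apply: le_trans (IHK _) _; rewrite -mulrA ler_wpM2l //.
    rewrite ler_wpM2r //; first by rewrite divr_ge0 ?subr_ge0 // ltW.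
    rewrite -!exprVn; apply: ler_weXn2l => //.
    by have := ltn_ord i; lia.
  rewrite -mulr_suml -[leRHS]mulrA ler_wpM2r //.
  apply: mulr_ge0; last by rewrite divr_ge0 ?subr_ge0 // ltW.
  by rewrite invr_ge0 exprn_ge0 // ltW.
under eq_bigr do rewrite add1n.
apply: le_trans (lerD (IHK r) (lerD mid (lexx _))) _.
rewrite (exprS _ K) -/u.
have yr : y ^- r = y * y ^- r.+1.
  by rewrite exprS invfM mulrA mulfV ?mul1r // gt_eqF.
rewrite yr; set q := y ^- r.+1.
have yq : 1 <= y * q by rewrite -yr -exprVn exprn_ege1.
have -> : d r.+1 * q * (((1 + eta * y) * u - 1) / eta) =
   d r.+1 * q * ((u - 1) / eta) + (eta * d r.+1 * (y * q) * ((u - 1) / eta) + d r.+1 * (y * q)).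
  by field; rewrite gt_eqF.
by rewrite lerD2l lerD2l ler_peMr.
Qed.

End PowCoefBound.

(** * Convolution estimate for the block weights *)

Lemma expn_self_mul_le a b : (a.+1 ^ a.+1 * b.+1 ^ b.+1 <= (a + b).+1 ^ (a + b).+1)%N.
Proof.
(* Bernoulli's inequality [1 + a <= (1 + a / (b + 1)) ^ (b + 1)], cleared of denominators. *)
have bern : (a.+1 * b.+1 ^ b.+1 <= (a + b).+1 ^ b.+1)%N.
  have /(_ b.+1) : forall m, (b.+1 ^ m * (b.+1 + m * a) <= b.+1 * (a + b).+1 ^ m)%N.
    elim=> [|m IHm]; first by rewrite !expn0 mul0n addn0 mul1n muln1.
    apply: (@leq_trans (b.+1 ^ m * (b.+1 + m * a) * (a + b).+1)).
      rewrite expnSr -!mulnA leq_mul2l; apply/orP; right; nia.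
    by rewrite [X in (_ <= _ * X)%N]expnSr mulnA leq_mul2r IHm orbT.
  move=> le; rewrite -(leq_pmul2l (ltn0Sn b)); apply: leq_trans le.
  by move: (b.+1 ^ b.+1)%N => x; apply: eq_leq; ring.
have -> : (a.+1 ^ a.+1 * b.+1 ^ b.+1 = a.+1 ^ a * (a.+1 * b.+1 ^ b.+1))%N.
  by rewrite expnSr mulnA.
rewrite -[X in (_ <= _ ^ X)%N]addnS expnD leq_mul //.
by have [->|a0] := posnP a; rewrite ?expn0 // leq_exp2r //; lia.
Qed.

Section Weights.
Variable R : realFieldType.

(* The index is the block size minus one. *)
Definition block_weight (k i : nat) : R := (i.+1 ^ (k * i.+1))%:R / i.+1`!%:R.

Notation q := (block_weight 2).

Lemma bernoulli (x : R) n : -1 <= x -> 1 + x *+ n <= (1 + x) ^+ n.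
Proof.
move=> x1; elim: n => [|n IHn]; first by rewrite mulr0n addr0.
rewrite exprSr; apply: le_trans (_ : (1 + x *+ n) * (1 + x) <= _).
  rewrite mulrS -mulr_natl; have : 0 <= n%:R * (x * x) by rewrite mulr_ge0 // -expr2 sqr_ge0.
  lra.
by rewrite ler_wpM2r //; lra.
Qed.

(** This is [(1 + 1 / i) ^ i]. For [i > 0], [i + 1] times its square is the ratio of the weights at
    [i] and [i - 1] when [k = 2]. *)
Definition euler_ratio (i : nat) : R := (i.+1%:R / i%:R) ^+ i.

(** The quotient of consecutive values is [(i + 1) / i * (1 - 1 / (i + 1) ^ 2) ^ (i + 1)], at least
    [1] by Bernoulli. *)
Lemma euler_ratio_mono i : (0 < i)%N -> euler_ratio i <= euler_ratio i.+1.
Proof.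
move=> i0; have I0 : (0 : R) < i%:R by rewrite ltr0n.
rewrite /euler_ratio.
have -> : (i.+2%:R / i.+1%:R : R) = (i.+1%:R / i%:R) * (1 - i.+1%:R ^- 2).
  by rewrite -[i.+2]addn2 -[i.+1]addn1 !natrD; field; lra.
rewrite [leRHS]exprMn [X in _ <= X * _]exprSr -mulrA ler_peMr //.
  by rewrite exprn_ge0 // divr_ge0.
have le : - 1 <= - (i.+1%:R : R) ^- 2.
  by rewrite lerN2 invf_le1 ?exprn_gt0 ?ltr0n // exprn_ege1 // ler1n.
have := bernoulli i.+1 le => b; apply: le_trans (_ : i.+1%:R / i%:R * (1 + (- i.+1%:R ^- 2) *+ i.+1) <= _).
  rewrite -(mulr_natl (- _)) -natr1.
  have -> : (i%:R + 1) / i%:R * (1 + (i%:R + 1) * (- (i%:R + 1) ^- 2)) = 1 :> R by field; lra.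
  by [].
by rewrite ler_wpM2l // divr_ge0.
Qed.

Lemma block_weight2S i : q i.+1 = q i * (i.+2%:R * euler_ratio i.+1 ^+ 2).
Proof.
rewrite /block_weight /euler_ratio -!exprM factS.
have nz : (i.+1`!%:R : R) != 0 by rewrite pnatr_eq0 -lt0n fact_gt0.
have nz1 : (i.+1%:R : R) != 0 by rewrite pnatr_eq0.
have nz2 : (i.+2%:R : R) != 0 by rewrite pnatr_eq0.
rewrite natrM !natrX expr_div_n (mulnC i.+1 2).
have nz3 := expf_neq0 (2 * i.+1) nz1.
rewrite [(2 * i.+2)%N](_ : _ = (2 * i.+1 + 2)%N) ?exprD; last by lia.
move: nz nz1 nz2 nz3; move: (i.+1`!%:R : R) (i.+1%:R ^+ (2 * i.+1)) (i.+2%:R ^+ (2 * i.+1)) => F x y.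
by move=> nz nz1 nz2 nz3; field; rewrite nz3 nz -[2 + _](natrD _ 2 i).
Qed.

Lemma block_weight_gt0 k i : 0 < block_weight k i.
Proof. by rewrite divr_gt0 // ltr0n ?fact_gt0 // expn_gt0. Qed.

Lemma euler_ratio_ge5 i : (5 <= i)%N -> 6 <= euler_ratio i ^+ 2.
Proof.
move=> i5; apply: (@le_trans _ _ (euler_ratio 5 ^+ 2)).
  by rewrite /euler_ratio; lra.
have E0 j : 0 <= euler_ratio j by rewrite exprn_ge0 // divr_ge0.
rewrite ler_pXn2r ?nnegrE // -(subnKC i5).
elim: (i - 5)%N => [|m IHm]; first by rewrite addn0.
by rewrite addnS; apply: le_trans IHm _; apply: euler_ratio_mono; lia.
Qed.

(** Ratios of consecutive weights increase, so the weights are log-convex and spreading two indices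
    apart increases the product. *)
Lemma block_weight2_exchange a b : (a <= b)%N -> q a.+1 * q b <= q a * q b.+1.
Proof.
move=> le; rewrite !block_weight2S mulrAC -mulrA ler_pM2l ?block_weight_gt0 //.
rewrite ler_pM2l ?block_weight_gt0 //.
have E0 j : 0 <= euler_ratio j by rewrite exprn_ge0 // divr_ge0.
apply: ler_pM; rewrite ?ler_nat //; first by rewrite exprn_ge0.
rewrite ler_pXn2r ?nnegrE //.
rewrite -(subnKC le); elim: (b - a)%N => [|m IHm]; first by rewrite addn0.
by rewrite addnS; apply: le_trans IHm _; apply: euler_ratio_mono.
Qed.

Lemma block_weight2_mul_le a b : (2 <= a)%N -> (2 <= b)%N ->
  q a * q b <= q 2 * q (a + b - 2)%N.
Proof.
wlog le : a b / (a <= b)%N => [wl|].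
  move=> a2 b2; case: (leqP a b) => [|/ltnW] le; first exact: wl.
  by rewrite mulrC addnC wl.
case: a le => [|[|a]] // le _ b2; rewrite (_ : (a.+2 + b - 2 = a + b)%N); last lia.
have {le} : (a.+1 <= b)%N by lia.
elim: a b {b2} => [|a IHa] b le; first by rewrite add0n.
apply: le_trans (block_weight2_exchange _) _ => //.
by apply: le_trans (IHa _ _) _; [lia | rewrite addSnnS].
Qed.

(** For [r <= 4] the sum is explicit. From [r = 5] on, the end terms give [16 * q r], and by
    log-convexity each of the [r - 2] inner terms is at most [q 2 * q (r - 1)]; the growth
    [6 * (i + 2) * q i <= q (i + 1)] absorbs both. *)
Lemma block_weight2_conv r :
  \sum_(i < r) q i.+1 * q (r - i)%N <= 3 / 4 * q r.+1.
Proof.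
have q0 : q 0 = 1 by rewrite /block_weight exp1n divr1.
have E1 : euler_ratio 1 = 2 by rewrite /euler_ratio; lra.
have q1 : q 1 = 8 by rewrite block_weight2S q0 E1; lra.
have E2 : euler_ratio 2 ^+ 2 = 81 / 16 by rewrite /euler_ratio; lra.
have q2 : q 2 = 243 / 2 by rewrite block_weight2S q1 E2; lra.
have pos i : 0 < q i := block_weight_gt0 2 i.
(* The factors [112 / 5] and, below, [59 / 2] are just under the true ratios [4 * (4 / 3) ^ 6] and
   [5 * (5 / 4) ^ 8]. *)
have q3 : 112 / 5 * q 2 <= q 3.
  rewrite [q 3]block_weight2S mulrC ler_pM2l //.
  by rewrite /euler_ratio; lra.
have q4 : 59 / 2 * q 3 <= q 4.
  rewrite [q 4]block_weight2S mulrC ler_pM2l //.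
  by rewrite /euler_ratio; lra.
have qS i : (4 <= i)%N -> 6 * i.+2%:R * q i <= q i.+1.
  move=> i4; rewrite block_weight2S [leLHS]mulrC ler_pM2l // mulrC ler_pM2l ?ltr0n //.
  by apply: euler_ratio_ge5.
have q5 := qS 4 isT.
case: r => [|[|[|[|[|r]]]]].
- by rewrite big_ord0 q1; lra.
- by rewrite big_ord1 /= subn0 q1 q2; lra.
- rewrite !big_ord_recr big_ord0 /= (_ : 2 - 1 = 1)%N // q1 q2.
  by rewrite q2 in q3; lra.
- rewrite !big_ord_recr big_ord0 /= (_ : 3 - 1 = 2)%N // (_ : 3 - 2 = 1)%N // q1 q2.
  by rewrite q2 in q3; lra.
- rewrite !big_ord_recr big_ord0 /= (_ : 4 - 1 = 3)%N // (_ : 4 - 2 = 2)%N //.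
  rewrite (_ : 4 - 3 = 1)%N // q1 q2.
  by rewrite q2 in q3; lra.
rewrite big_ord_recl big_ord_recr /= subn0 /bump /= !add1n.
have -> : (r.+4.+1 - r.+4 = 1)%N by lia.
rewrite q1.
have mid : \sum_(i < r.+3) q (1 + i).+1 * q (r.+4.+1 - (1 + i))%N <= r.+3%:R * (243 / 2 * q r.+4).
  apply: (@le_trans _ _ (\sum_(i < r.+3) (243 / 2 * q r.+4))); last first.
    by rewrite sumr_const card_ord [leRHS]mulr_natl.
  apply: ler_sum => i _; rewrite -q2 add1n.
  have := ltn_ord i => lti.
  have := @block_weight2_mul_le i.+2 (r.+4.+1 - i.+1)%N isT.
  have -> : (i.+2 + (r.+4.+1 - i.+1) - 2 = r.+4)%N by lia.
  by apply; lia.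
have h1 := qS r.+4 isT; have h2 := qS r.+4.+1 isT.
move: mid; set S := \sum_(i < _) _ => mid.
have p4 := pos r.+4; have p5 := pos r.+4.+1.
rewrite (natrD R 3 r) in mid; rewrite (natrD R 6 r) in h1; rewrite (natrD R 7 r) in h2.
have x0 : (0 : R) <= r%:R by rewrite ler0n.
move: (r%:R : R) (q r.+4) (q r.+4.+1) (q r.+4.+2) x0 p4 p5 mid h1 h2.
move=> x a b c x0 p4 p5 mid h1 h2.
suff h3 : (3 + x) * (243 / 2 * a) <= (9 / 2 * (7 + x) - 16) * b by lra.
have x6 : 0 < 6 + x by lra.
rewrite -(ler_pM2l x6).
have h4 : (3 + x) * (6 * (6 + x) * a) <= (3 + x) * b by rewrite ler_wpM2l //; lra.
have xb : 0 <= x * b by rewrite mulr_ge0 // ltW.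
have xxb : 0 <= x * (x * b) by rewrite mulr_ge0.
lra.
Qed.

(** The weight for [k] is the one for [2] times the power [k - 2] of [(i + 1) ^ (i + 1)];
    [expn_self_mul_le] bounds products of these extra factors. *)
Lemma block_weight_conv k r : (2 <= k)%N ->
  \sum_(i < r) block_weight k i.+1 * block_weight k (r - i)%N <=
    3 / 4 * block_weight k r.+1.
Proof.
move=> k2.
have bwE i : block_weight k i = ((i.+1 ^ i.+1) ^ (k - 2))%:R * q i.
  rewrite /block_weight mulrA -natrM -expnM -expnD; congr ((_ ^ _)%:R / _).
  by rewrite -[in LHS](subnK k2); lia.
rewrite bwE mulrCA; apply: le_trans (ler_wpM2l (ler0n _ _) (block_weight2_conv r)).
rewrite mulr_sumr; apply: ler_sum => i _.
rewrite !bwE mulrACA ler_wpM2r //; first by apply: mulr_ge0; apply/ltW/block_weight_gt0.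
rewrite -natrM ler_nat -expnMn.
have [->|k3] := posnP (k - 2)%N; rewrite ?expn0 // leq_exp2r //.
by apply: leq_trans (expn_self_mul_le _ _) _; rewrite addSn subnKC // ltnW.
Qed.

(** Here [eta = 3 / 4], hence the factor [4 / 3]. Dropping the [- 1] of the general bound lets the
    case [r = 0] fit too. *)
Lemma pow_coef_block_weight_le (k K r : nat) (y : R) : (2 <= k)%N -> 0 < y <= 1 ->
  pow_coef (block_weight k) K.+1 r <=
    block_weight k r * y ^- r * (4 / 3 * (1 + 3 / 4 * y) ^+ K.+1).
Proof.
move=> k2 y01; have w0 : block_weight k 0 = 1.
  by rewrite /block_weight exp1n divr1.
have wge i : 0 <= block_weight k i by apply/ltW/block_weight_gt0.
have u1 : 1 <= (1 + 3 / 4 * y) ^+ K.+1 by rewrite exprn_ege1 //; lra.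
case: r => [|r].
  by rewrite pow_coef_r0 // w0 expr0 invr1; lra.
have eta0 : (0 : R) < 3 / 4 by lra.
apply: le_trans (@pow_coef_le _ _ _ _ K.+1 r w0 wge eta0 y01 _) _.
  by move=> r'; apply: block_weight_conv.
rewrite ler_wpM2l //; last by lra.
by rewrite mulr_ge0 // invr_ge0 exprn_ge0 //; lra.
Qed.

End Weights.

(** * Binomial quotients for the union bound *)

Lemma leq_bin_mul a b c d : ('C(a, c) * 'C(b, d) <= 'C(a + b, c + d))%N.
Proof.
rewrite -binomial.Vandermonde; have lt : (c < (c + d).+1)%N by rewrite ltnS leq_addr.
by rewrite (bigD1 (Ordinal lt)) //= addKn leq_addr.
Qed.

Lemma leq_expn_bin k n j : ('C(n, j) ^ k <= 'C(k * n, k * j))%N.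
Proof.
elim: k => [|k IHk]; first by rewrite !mul0n bin0.
by rewrite expnS !mulSn; apply: leq_trans (leq_bin_mul _ _ _ _); rewrite leq_mul2l IHk orbT.
Qed.

Section UnionTerm.
Variable R : realFieldType.

(** For [e <= m] the quotient is ['C(N - e, m - e) / 'C(N, m)], and its numerator is bounded through
    one term of the expansion of [(p + 1) ^ (N - e)]. The dependence on [e] becomes the power
    [p ^- e], whose mean factorises over independent choices. *)
Lemma bin_ratio_le (p e m N : nat) : (0 < p)%N -> (m <= N)%N -> (e <= N)%N ->
  ('C(m, e)%:R / 'C(N, e)%:R : R) <=
    (p.+1%:R / p%:R) ^+ N * p%:R ^+ m / 'C(N, m)%:R * p%:R ^- e.
Proof.
move=> p0 mN eN; have P0 : (0 : R) < p%:R by rewrite ltr0n.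
have [lt|em] := ltnP m e.
  rewrite bin_small // mul0r !mulr_ge0 ?invr_ge0 ?exprn_ge0 ?divr_ge0 //.
have c1 : ('C(N, e)%:R : R) != 0 by rewrite pnatr_eq0 -lt0n bin_gt0.
have c2 : ('C(N, m)%:R : R) != 0 by rewrite pnatr_eq0 -lt0n bin_gt0.
have E : ('C(N, m)%:R * 'C(m, e)%:R = 'C(N, e)%:R * 'C(N - e, m - e)%:R :> R).
  by rewrite -!natrM mul_bin_bin.
have -> : ('C(m, e)%:R / 'C(N, e)%:R = 'C(N - e, m - e)%:R / 'C(N, m)%:R :> R).
  by apply/eqP; rewrite eqr_div // mulrC E mulrC.
rewrite mulrAC ler_wpM2r ?invr_ge0 //.
have le : 'C(N - e, m - e)%:R * p%:R ^+ (N - m) <= p.+1%:R ^+ (N - e) :> R.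
  rewrite -!natrX -natrM ler_nat -addn1 expnDn.
  have lt : (m - e < (N - e).+1)%N by lia.
  rewrite (bigD1 (Ordinal lt)) //= exp1n muln1.
  have -> : (N - e - (m - e) = N - m)%N by lia.
  exact: leq_addr.
rewrite -(ler_pM2r (exprn_gt0 (N - m) P0)); apply: le_trans le _.
have -> : (p.+1%:R / p%:R) ^+ N * p%:R ^+ m * p%:R ^- e * p%:R ^+ (N - m) =
    p.+1%:R ^+ (N - e) * (p.+1%:R / p%:R) ^+ e :> R.
  rewrite mulrAC -(mulrA _ (p%:R ^+ m)) -exprD subnKC // !expr_div_n.
  have -> : p.+1%:R ^+ N = p.+1%:R ^+ (N - e) * p.+1%:R ^+ e :> R by rewrite -exprD subnK.
  field.
  by rewrite !expf_neq0 // gt_eqF.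
rewrite ler_peMr ?exprn_ge0 // exprn_ege1 // ler_pdivlMr // mul1r.
by rewrite ler_nat.
Qed.

(* With [p = n - 1], the contribution of the partitions of [n] vertices into
   [j + 1] blocks to the union bound. *)
Definition union_term (k p j : nat) : R :=
  (p.+1%:R / p%:R) ^+ (k * p.+1) * p%:R ^+ (k * j) / 'C(k * p.+1, k * j)%:R *
  'C(p, j.-1)%:R / p%:R ^+ (k * p.+1) *
  (p.+1`!%:R / j.+1`!%:R * pow_coef (block_weight R k) j.+1 (p - j)).

End UnionTerm.

(** * The union bound *)

Lemma card_kout_edges n (c : {ffun 'I_n -> {set 'I_n}}) (Q : pred ('I_n * 'I_n)) :
  #|[set e : kout_edge c | Q (val e)]| = (\sum_i #|[set j in c i | Q (i, j)]|)%N.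
Proof.
rewrite -(card_imset (f := val)); last exact: val_inj.
under eq_bigr do rewrite -sum1_card.
rewrite pair_big_dep /= -sum1_card; apply: eq_bigl => -[i j] /=.
rewrite inE /=; apply/imsetP/andP => [[[x xc]]|[ji Qij]].
  by rewrite inE /= => Qx E; move: xc Qx; rewrite -E.
have ij : (i, j).2 \in c (i, j).1 by [].
by exists (Sub (i, j) ij); rewrite ?inE.
Qed.

Lemma card_kout_edge n (c : {ffun 'I_n -> {set 'I_n}}) :
  #|{: kout_edge c}| = (\sum_i #|c i|)%N.
Proof.
rewrite -cardsT; apply: etrans (card_kout_edges c xpredT) _; apply: eq_bigr => i _.
by apply: eq_card => j; rewrite inE andbT.
Qed.

Lemma card_crossing_kout n (c : {ffun 'I_n -> {set 'I_n}}) (P : {set {set 'I_n}}) :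
  partition P [set: 'I_n] ->
  #|crossing (@kout_ends n c) P| = (\sum_i #|c i :\: pblock P i|)%N.
Proof.
move=> partP; have [_ triP _] := and3P partP.
rewrite (card_kout_edges c (fun e => pblock P e.1 != pblock P e.2)).
apply: eq_bigr => i _; apply: eq_card => j; rewrite !inE andbC /=; congr (~~ _ && _).
rewrite eq_sym; apply/eqP/idP => [<-|]; last exact: same_pblock.
by rewrite mem_pblock (cover_partition partP) inE.
Qed.

Section ColourCopies.
Variables (q rho : nat) (pop : {set 'I_q}).

Lemma card_colour_copy : #|{: colour_copy rho pop}| = (q * rho + #|pop|)%N.
Proof.
rewrite card_tagged sumnE big_map big_enum /=.
under eq_bigr do rewrite card_ord.
rewrite big_split /= sum_nat_const card_ord; congr addn.
by rewrite -sum1_card [RHS]big_mkcond; apply: eq_bigr => x _; case: (x \in pop).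
Qed.

Lemma card_copies_of (x : 'I_q) :
  #|(fun y : colour_copy rho pop => tag y) @^-1: [set x]| = (rho + (x \in pop))%N.
Proof.
transitivity #|[set Tagged (fun x => 'I_(rho + (x \in pop))) i | i in [set: 'I_(rho + (x \in pop))]]|.
  apply: eq_card => -[y i]; rewrite !inE /=; apply/eqP/imsetP => [E|[j _ E]].
    by move: i; rewrite E => i; exists i; rewrite ?inE.
  by have := congr1 tag E.
rewrite card_imset ?cardsT ?card_ord //.
by move=> i j /eqP; rewrite eq_Tagged => /eqP.
Qed.

End ColourCopies.

Section UnionBound.
Variables (R : realType) (k p q : nat) (pop : {set 'I_q}).
Hypotheses (k2 : (2 <= k)%N) (kp : (k <= p)%N) (pq : (p <= q)%N).
Let N := (k * p.+1)%N.
Let rho := (N %/ q)%N.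
Hypothesis cardpop : #|pop| = (N - q * rho)%N.
Implicit Types (c : {ffun 'I_p.+1 -> {set 'I_p.+1}}) (P : {set {set 'I_p.+1}}).

Let p_gt0 : (0 < p)%N. Proof. by lia. Qed.

Let card_copies : #|{: colour_copy rho pop}| = N.
Proof. by rewrite card_colour_copy cardpop subnKC // mulnC leq_divM. Qed.

(** If [rho >= k], each of the [q >= p] classes contributes [k] to the sum in [card_few_colours];
    otherwise no class exceeds [k] and the sum is [N]. The [k] copies beyond [k * p] turn [k * t]
    into [k * t.+1]. *)
Lemma few_colours_copies e t : (t <= p)%N ->
  (#|[set Y : {set colour_copy rho pop} | (#|Y| == e) &&
      (#|[set tag y | y in Y]| <= t)]| <= 'C(p, t) * 'C(k * t.+1, e))%N.
Proof.
move=> tp; have k0 : (0 < k)%N by lia.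
have := @card_few_colours (colour_copy rho pop) 'I_q (fun y => tag y) k p e t k0 tp.
rewrite card_copies /N (_ : k * t + (k * p.+1 - k * p) = k * t.+1)%N; last first.
  by rewrite -mulnBr subSnn muln1 mulnSr.
apply; under eq_bigr do rewrite card_copies_of.
have [krho|rhok] := leqP k rho.
  rewrite (eq_bigr (fun=> k)) => [|x _].
    by rewrite sum_nat_const card_ord mulnC leq_mul2r pq orbT.
  by apply/minn_idPl; apply: leq_trans krho _; apply: leq_addr.
rewrite (eq_bigr (fun x => rho + (x \in pop)))%N => [|x _].
  rewrite big_split /= sum_nat_const card_ord.
  have -> : (\sum_(i < q) (i \in pop) = #|pop|)%N.
    by rewrite -sum1_card [RHS]big_mkcond; apply: eq_bigr => x _; case: (x \in pop).
  by rewrite -card_colour_copy card_copies leq_mul2l leqnSn orbT.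
by apply/minn_idPr; case: (x \in pop); rewrite ?addn1 ?addn0 // ltnW.
Qed.

Definition weight c : R := \prod_i unif R (neighbour_sets k i) (c i).

Lemma unif_ge0 (T : finType) (D : {set T}) x : 0 <= unif R D x.
Proof. by rewrite divr_ge0. Qed.

Lemma weight_ge0 c : 0 <= weight c.
Proof. by apply: prodr_ge0 => i _; apply: unif_ge0. Qed.

Lemma weight_neq0 c : weight c != 0 -> forall i, c i \in neighbour_sets k i.
Proof.
move=> nz i; apply: contraNT nz => /negbTE ci.
by rewrite /weight (bigD1 i) //= /unif ci !mul0r.
Qed.

Let bin_pk_gt0 : (0 : R) < 'C(p, k)%:R.
Proof. by rewrite ltr0n bin_gt0. Qed.

Lemma sum_weight : \sum_c weight c = 1.
Proof.
rewrite /weight -(bigA_distr_bigA (fun i S => unif R (neighbour_sets k i) S)) /=.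
rewrite big1 // => i _; rewrite /unif -mulr_suml -natr_sum.
under eq_bigr do rewrite -[nat_of_bool _]/(if _ then 1%N else 0%N).
rewrite -big_mkcond sum1_card card_neighbour_sets divff // gt_eqF //.
Qed.

Definition success_given c : R :=
  \sum_(b : {ffun kout_edge c -> colour_copy rho pop})
    unif R (bijections _ _) b *
      (`[< has_rainbow_spanning_tree (@kout_ends p.+1 c) (fun e => tag (b e)) >])%:R.

Lemma prob_success :
  prob_rainbow_spanning_tree R p.+1 k pop = \sum_c weight c * success_given c.
Proof. by []. Qed.

Lemma card_kout_edge_weight c : weight c != 0 -> #|{: kout_edge c}| = N.
Proof.
move=> /weight_neq0 cn; rewrite card_kout_edge.
rewrite (eq_bigr (fun=> k)) => [|i _]; first by rewrite sum_nat_const card_ord mulnC.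
by have := cn i; rewrite inE => /andP [/eqP].
Qed.

Definition nontrivial_partition P := partition P [set: 'I_p.+1] && (2 <= #|P|)%N.

Definition crossings c P := (\sum_i #|c i :\: pblock P i|)%N.

(** By the criterion, a failure yields a partition whose crossing edges carry at most [#|P| - 2]
    colours. The copies assigned to these edges form a uniform set, so counting few-coloured sets
    gives each term. *)
Lemma failure_given_le c : weight c != 0 ->
  1 - success_given c <=
  \sum_(P | nontrivial_partition P)
    ('C(p, #|P| - 2) * 'C(k * (#|P| - 1), crossings c P))%:R / 'C(N, crossings c P)%:R.
Proof.
move=> nz; have cE := card_kout_edge_weight nz.
have cEN : #|{: kout_edge c}| = #|{: colour_copy rho pop}| by rewrite cE card_copies.
have mass : \sum_(b : {ffun kout_edge c -> colour_copy rho pop}) unif R (bijections _ _) b = 1.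
  under eq_bigr do rewrite -[unif _ _ _]mulr1.
  rewrite (sum_unif R (bijections (kout_edge c) (colour_copy rho pop)) xpredT).
  have -> : [set x in bijections (kout_edge c) (colour_copy rho pop) | true] = bijections _ _.
    by apply/setP => b; rewrite !inE andbT.
  by rewrite divff // pnatr_eq0 -lt0n card_bijections_gt0.
rewrite -[X in X - _]mass /success_given -sumrB.
pose few P (Y : {set colour_copy rho pop}) := (#|[set tag y | y in Y]| <= #|P| - 2)%N.
apply: (@le_trans _ _ (\sum_(b : {ffun kout_edge c -> colour_copy rho pop})
  \sum_(P | nontrivial_partition P) unif R (bijections _ _) b *
     (few P [set b e | e in crossing (@kout_ends p.+1 c) P])%:R)).
  apply: ler_sum => b _; set h := `[< _ >].
  rewrite -[X in X - _]mulr1 -mulrBr -mulr_sumr ler_wpM2l ?unif_ge0 //.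
  case: (boolP h) => [_|/asboolP nh]; first by rewrite subrr sumr_ge0.
  have [P ntP fewP] : exists2 P, nontrivial_partition P &
      few P [set b e | e in crossing (@kout_ends p.+1 c) P].
    apply: contrapT => noP; apply: nh; apply: rainbow_spanning_tree_criterion => P partP P2.
    rewrite leqNgt; apply/negP => lt; apply: noP; exists P.
      by rewrite /nontrivial_partition partP.
    rewrite /few -imset_comp; rewrite (eq_imset _ (g := fun e => tag (b e))) //.
    by rewrite leq_subRL // add2n.
  by rewrite (bigD1 P) //= fewP subr0 lerDl sumr_ge0.
rewrite exchange_big /=; apply: ler_sum => P /andP [partP P2].
rewrite (sum_unif_bijections R cEN _ (few P)) card_copies card_crossing_kout //.
rewrite ler_wpM2r ?invr_ge0 // ler_nat.
have PN : (#|P| <= p.+1)%N by rewrite -[leqRHS]card_ord -cardsT card_partition_le.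
have -> : (#|P| - 1 = (#|P| - 2).+1)%N by lia.
by apply: few_colours_copies; lia.
Qed.

(** Independence factorises the mean over the vertices. A vertex of block [A] contributes at most
    [(#|A| / p) ^ k]; the factors are then grouped by block. *)
Lemma sum_weight_crossings P : partition P [set: 'I_p.+1] ->
  \sum_c weight c * p%:R ^- crossings c P <=
  (\prod_(A in P) (#|A| ^ (k * #|A|))%:R) / p%:R ^+ N.
Proof.
move=> partP; have [_ triP _] := and3P partP.
have P0 : (0 : R) < p%:R by rewrite ltr0n.
have -> : \sum_c weight c * p%:R ^- crossings c P =
   \prod_i \sum_S unif R (neighbour_sets k i) S * p%:R ^- #|S :\: pblock P i|.
  rewrite bigA_distr_bigA /=; apply: eq_bigr => c _.
  rewrite big_split /=; congr (_ * _).
  by rewrite /crossings -exprVn expr_sum; apply: eq_bigr => i _; rewrite exprVn.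
apply: (@le_trans _ _ (\prod_(i < p.+1) ((#|pblock P i| ^ k)%:R / p%:R ^+ k))).
  apply: ler_prod => i _; apply/andP; split.
    by apply: sumr_ge0 => S _; rewrite mulr_ge0 ?unif_ge0 ?invr_ge0 ?exprn_ge0.
  have iP : i \in pblock P i by rewrite mem_pblock (cover_partition partP) inE.
  have le := sum_neighbour_sets k iP.
  have -> : \sum_S unif R (neighbour_sets k i) S * p%:R ^- #|S :\: pblock P i| =
      (\sum_(S in neighbour_sets k i) p ^ #|S :&: pblock P i|)%:R / 'C(p, k)%:R / p%:R ^+ k.
    rewrite natr_sum !mulr_suml [RHS]big_mkcond; apply: eq_bigr => S _.
    rewrite /unif card_neighbour_sets; case: (boolP (S \in _)) => [|_]; last by rewrite !mul0r.
    rewrite inE => /andP [/eqP cS _]; rewrite mul1r natrX mulrC mulrAC; congr (_ / _).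
    rewrite -[in RHS]cS -(cardsID (pblock P i) S) exprD invfM mulrA mulfV ?mul1r //.
    by rewrite expf_neq0 // gt_eqF.
  rewrite ler_wpM2r ?invr_ge0 ?exprn_ge0 // ler_pdivrMr // -natrM ler_nat mulnC.
  exact: le.
rewrite big_split /= prodr_const card_ord -exprVn -exprM -/N.
rewrite -[(p%:R ^+ N)^-1]exprVn ler_wpM2r ?exprn_ge0 ?invr_ge0 //.
rewrite le_eqVlt; apply/orP; left; apply/eqP.
rewrite -(eq_bigl _ _ (fun i => in_setT i)).
rewrite (set_partition_big _ partP) /=; apply: eq_bigr => A AP.
rewrite (eq_bigr (fun=> (#|A| ^ k)%:R)) => [|i iA].
  by rewrite prodr_const -natrX -expnM.
by rewrite (def_pblock triP AP iA).
Qed.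

Lemma union_term_partitions j : (j <= p)%N ->
  \sum_(P | partition P [set: 'I_p.+1] && (#|P| == j.+1))
    (\prod_(A in P) (#|A| ^ (k * #|A|))%:R) <=
  p.+1`!%:R / j.+1`!%:R * pow_coef (block_weight R k) j.+1 (p - j).
Proof.
move=> jp; have F0 : (0 : R) < j.+1`!%:R by rewrite ltr0n fact_gt0.
have := @sum_partitions_le R 'I_p.+1 (fun v => (v ^ (k * v))%:R) j.+1 setT.
rewrite cardsT card_ord subSS => /(_ (fun v => ler0n _ _) jp) le.
by rewrite mulrAC ler_pdivlMr // mulrC.
Qed.

Theorem failure_le :
  1 - prob_rainbow_spanning_tree R p.+1 k pop <=
  \sum_(j < p.+1 | (0 < j)%N) union_term R k p j.
Proof.
have P0 : (0 : R) < p%:R by rewrite ltr0n.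
rewrite prob_success -[X in X - _]sum_weight -sumrB.
(* These factors depend on a partition only through its number of blocks [j + 1]. *)
pose cst j : R := (p.+1%:R / p%:R) ^+ N * p%:R ^+ (k * j) / 'C(N, k * j)%:R * 'C(p, j.-1)%:R.
have cst_ge0 j : 0 <= cst j by rewrite !mulr_ge0 ?exprn_ge0 ?invr_ge0 // divr_ge0.
apply: (@le_trans _ _ (\sum_c \sum_(P | nontrivial_partition P)
    weight c * (cst (#|P| - 1)%N * p%:R ^- crossings c P))).
  apply: ler_sum => c _; rewrite -[X in X - _]mulr1 -mulrBr -mulr_sumr.
  have [->|nz] := eqVneq (weight c) 0; first by rewrite !mul0r.
  rewrite ler_wpM2l ?weight_ge0 //; apply: le_trans (failure_given_le nz) _.
  apply: ler_sum => P /andP [partP P2].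
  have PN : (#|P| <= p.+1)%N by rewrite -[leqRHS]card_ord -cardsT card_partition_le.
  rewrite natrM -mulrA /cst (_ : #|P| - 2 = (#|P| - 1).-1)%N; last by lia.
  rewrite -[leRHS]mulrA [leRHS]mulrCA ler_wpM2l //.
  apply: le_trans (bin_ratio_le _ p_gt0 _ _) _ => //.
  - by rewrite /N leq_mul2l; apply/orP; right; lia.
  by rewrite /crossings -(card_kout_edge_weight nz) -(card_crossing_kout c partP) max_card.
rewrite exchange_big /=.
apply: (@le_trans _ _ (\sum_(P | nontrivial_partition P) cst (#|P| - 1)%N *
    ((\prod_(A in P) (#|A| ^ (k * #|A|))%:R) / p%:R ^+ N))).
  apply: ler_sum => P /andP [partP P2].
  under eq_bigr do rewrite mulrCA.
  by rewrite -mulr_sumr ler_wpM2l // sum_weight_crossings.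
rewrite (partition_big (fun P : {set {set 'I_p.+1}} => inord (#|P| - 1)%N : 'I_p.+1) (fun j => (0 < j)%N)) /=; last first.
  move=> P /andP [partP P2].
  have PN : (#|P| <= p.+1)%N by rewrite -[leqRHS]card_ord -cardsT card_partition_le.
  have lt : (#|P| - 1 < p.+1)%N by lia.
  by rewrite inordK // subn_gt0.
apply: ler_sum => j j0; have jp : (j <= p)%N by rewrite -ltnS.
rewrite /union_term -/N; apply: le_trans (ler_wpM2l _ (union_term_partitions jp)); last first.
  by rewrite !mulr_ge0 ?exprn_ge0 ?invr_ge0 ?exprn_ge0 // divr_ge0.
rewrite -/(cst j) mulr_sumr [leLHS]big_mkcond [leRHS]big_mkcond; apply: ler_sum => P _.
have nn : 0 <= \prod_(A in P) (#|A| ^ (k * #|A|))%:R :> R by apply: prodr_ge0.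
case: ifP => [/andP [/andP [partP P2] /eqP E]|_]; last first.
  by case: ifP => // _; rewrite mulr_ge0 // mulr_ge0 // invr_ge0 exprn_ge0.
have PN : (#|P| <= p.+1)%N by rewrite -[leqRHS]card_ord -cardsT card_partition_le.
have Ej : (#|P| - 1)%N = j.
  by rewrite -E inordK // ltnS leq_subLR add1n.
have -> : #|P| == j.+1 by rewrite -Ej subn1 prednK // ltnW.
by rewrite partP /= Ej mulrCA mulrC.
Qed.

Lemma sum_unif_le1 (T : finType) (D : {set T}) : \sum_x unif R D x <= 1.
Proof.
have := sum_unif R D xpredT; under eq_bigr do rewrite mulr1; move=> ->.
have -> : [set x in D | true] = D by apply/setP => x; rewrite !inE andbT.
have [->|nz] := eqVneq (#|D|%:R : R) 0; first by rewrite mul0r.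
by rewrite divff.
Qed.

Lemma prob_le1 : prob_rainbow_spanning_tree R p.+1 k pop <= 1.
Proof.
rewrite prob_success -[leRHS]sum_weight; apply: ler_sum => c _.
rewrite ler_piMr ?weight_ge0 //.
  apply: le_trans (sum_unif_le1 (bijections (kout_edge c) (colour_copy rho pop))).
by apply: ler_sum => b _; rewrite ler_piMr ?unif_ge0 // lern1 leq_b1.
Qed.

End UnionBound.

From mathcomp Require Import all_classical all_reals all_analysis.
Import numFieldNormedType.Exports.

(** * Exponential decay and summation of the union terms *)

Section Decay.
Variable R : realType.

(** Apply [1 + z <= exp z] to both powers: as [s * (1 - y) = j * y = x], they give [exp (- x)] and
    [exp (3 / 4 * x)]. The spare factors [y] and [1 + 3 / 4 * y] have product at most [2]. *)
Lemma decay_le (y x : R) (s j : nat) : 0 < y -> x = j%:R * y -> y = 1 - j%:R / (s + j)%:R ->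
  (0 < s)%N -> (0 < j)%N ->
  y ^+ s.+1 * (1 + 3 / 4 * y) ^+ j.+1 <= 2 * expR (- (x / 4)).
Proof.
move=> y0 xE yE s0 j0.
have S0 : (0 : R) < s%:R by rewrite ltr0n.
have J0 : (0 : R) < j%:R by rewrite ltr0n.
have yE' : y = s%:R / (s + j)%:R.
  by rewrite yE natrD; field; lra.
have y1 : y <= 1.
  by rewrite yE gerBl divr_ge0.
have le1 : y ^+ s <= expR (- x).
  have -> : - x = s%:R * (y - 1).
    by rewrite xE yE' natrD; field; lra.
  rewrite expRM_natl lerXn2r ?nnegrE ?expR_ge0 //; first exact: ltW.
  by have := expR_ge1Dx (y - 1); rewrite addrC subrK.
have le2 : (1 + 3 / 4 * y) ^+ j <= expR (3 / 4 * x).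
  have -> : 3 / 4 * x = j%:R * (3 / 4 * y) by rewrite xE; ring.
  rewrite expRM_natl lerXn2r ?nnegrE ?expR_ge0 //; first by lra.
  exact: expR_ge1Dx.
have -> : - (x / 4) = - x + 3 / 4 * x by field.
rewrite expRD !exprS.
have p1 : 0 <= y ^+ s by rewrite exprn_ge0 // ltW.
have p2 : 0 <= (1 + 3 / 4 * y) ^+ j by rewrite exprn_ge0 //; lra.
have := ler_pM p1 p2 le1 le2.
set A := y ^+ s in p1 *; set B := (1 + _) ^+ j in p2 *; move=> le.
apply: (@le_trans _ _ (2 * (A * B))); last by rewrite ler_pM2l.
have -> : y * A * ((1 + 3 / 4 * y) * B) = (y * (1 + 3 / 4 * y)) * (A * B) by ring.
rewrite ler_wpM2r ?mulr_ge0 //.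
by nra.
Qed.

(** With [n = p + 1], the choice is [y = s / n] for [s = n - j], the size of a giant block beside
    [j] singletons. Up to powers of [Q = n / p], the term becomes the product in [decay_le]. *)
Lemma union_term_le (k p j : nat) : (2 <= k)%N -> (0 < j <= p)%N ->
  union_term R k p j <=
    (p.+1%:R / p%:R) ^+ (k.+2 * p.+1) * (8 / 3) / p.+1%:R *
    expR (- (j%:R * (p.+1 - j)%:R / p.+1%:R / 4)).
Proof.
move=> k2 /andP [j0 jp].
set s := (p.+1 - j)%N; have s0 : (0 < s)%N by rewrite /s; lia.
have sj : (s + j = p.+1)%N by rewrite /s; lia.
have sp : (s <= p)%N by rewrite /s; lia.
have p0 : (0 < p)%N by lia.
have P0 : (0 : R) < p%:R by rewrite ltr0n.
have N0 : (0 : R) < p.+1%:R by rewrite ltr0n.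
have S0 : (0 : R) < s%:R by rewrite ltr0n.
pose Q : R := p.+1%:R / p%:R; pose y : R := s%:R / p.+1%:R.
have Q1 : 1 <= Q by rewrite ler_pdivlMr // mul1r ler_nat.
have Q0 : 0 <= Q := le_trans ler01 Q1.
have y0 : 0 < y by rewrite divr_gt0.
have y_ge0 := ltW y0.
have y1 : y <= 1 by rewrite ler_pdivrMr // mul1r ler_nat -sj leq_addr.
rewrite /union_term (_ : (p - j)%N = s.-1); last by rewrite /s; lia.
set x := j%:R * _ / _.
have xE : x = j%:R * y by rewrite /x /y mulrA.
have yE : y = 1 - j%:R / (s + j)%:R.
  by rewrite /y -sj natrD; field; have := ler0n R j; lra.
have dec := decay_le y0 xE yE s0 j0.
set c := 'C(k * p.+1, k * j)%:R.
have c0 : 0 < c by rewrite ltr0n bin_gt0 leq_mul2l (leqW jp) orbT.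
have c_ge0 := ltW c0.
have F0 m : (0 : R) < m`!%:R by rewrite ltr0n fact_gt0.
(* This rests on [n * 'C(p, j - 1) = j * 'C(n, j)] and ['C(n, j) ^ 2 <= 'C(n, j) ^ k <= 'C(k * n, k
   * j)]. *)
have a_le : 'C(p, j.-1)%:R * (p.+1`!%:R / j.+1`!%:R / s`!%:R) / c <= p.+1%:R^-1.
  have fE : p.+1`!%:R / j.+1`!%:R / s`!%:R = 'C(p.+1, j)%:R / j.+1%:R :> R.
    rewrite -(bin_fact (leqW jp)) -/s factS !natrM.
    have := lt0r_neq0 (F0 j); have := lt0r_neq0 (F0 s).
    move: (j`!%:R : R) (s`!%:R : R) => f g g0 f0; field.
    by rewrite g0 f0 -[1 + _](natrD R 1 j) pnatr_eq0.
  rewrite fE ler_pdivrMr // -(ler_pM2l N0) [leRHS]mulrA mulfV ?gt_eqF // mul1r.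
  rewrite !mulrA ler_pdivrMr ?ltr0n // /c -!natrM ler_nat.
  have := mul_bin_diag p.+1 j.-1; rewrite /= prednK // => ->.
  rewrite -mulnA mulnn [leqRHS]mulnC.
  apply: (@leq_trans (j.+1 * 'C(p.+1, j) ^ k)); last first.
    by rewrite leq_mul2l leq_expn_bin orbT.
  by rewrite leq_mul // leq_pexp2l // bin_gt0 leqW.
(* As [s <= p], the exponent [k * s] of [s / p = y * Q] may be lowered to [2 * s]. *)
have b_le : p%:R ^+ (k * j) / p%:R ^+ (k * p.+1) * (s ^ (k * s))%:R <=
    y ^+ (2 * s) * Q ^+ (2 * p.+1).
  have -> : p%:R ^+ (k * j) / p%:R ^+ (k * p.+1) * (s ^ (k * s))%:R =
      (s%:R / p%:R) ^+ (k * s) :> R.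
    rewrite -sj mulnDr exprD natrX expr_div_n; field.
    by rewrite !expf_neq0 // gt_eqF.
  have sp1 : s%:R / p%:R <= 1 :> R by rewrite ler_pdivrMr // mul1r ler_nat.
  apply: (@le_trans _ _ ((s%:R / p%:R) ^+ (2 * s))).
    rewrite ler_wiXn2l ?divr_ge0 //.
    by rewrite leq_mul2r k2 orbT.
  have -> : s%:R / p%:R = y * Q by rewrite /y /Q; field; rewrite !gt_eqF.
  rewrite exprMn ler_wpM2l //; first by rewrite exprn_ge0 // ltW.
  rewrite ler_weXn2l //.
  by rewrite leq_mul2l /= leqW.
have y01 : 0 < y <= 1 by rewrite y0.
have pc_le := pow_coef_block_weight_le j s.-1 k2 y01.
rewrite {2}/block_weight prednK // in pc_le.
set U := 4 / 3 * _ in pc_le.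
have U0 : 0 <= U by rewrite mulr_ge0 ?exprn_ge0 //; lra.
set pc := pow_coef _ _ _ in pc_le *.
apply: (@le_trans _ _ (Q ^+ (k * p.+1) *
    ('C(p, j.-1)%:R * (p.+1`!%:R / j.+1`!%:R / s`!%:R) / c) *
    (p%:R ^+ (k * j) / p%:R ^+ (k * p.+1) * (s ^ (k * s))%:R) * (y ^- s.-1 * U))).
  have -> : Q ^+ (k * p.+1) *
    ('C(p, j.-1)%:R * (p.+1`!%:R / j.+1`!%:R / s`!%:R) / c) *
    (p%:R ^+ (k * j) / p%:R ^+ (k * p.+1) * (s ^ (k * s))%:R) * (y ^- s.-1 * U) =
    Q ^+ (k * p.+1) * p%:R ^+ (k * j) / c * 'C(p, j.-1)%:R / p%:R ^+ (k * p.+1) *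
    (p.+1`!%:R / j.+1`!%:R * ((s ^ (k * s))%:R / s`!%:R * y ^- s.-1 * U)).
    ring.
  rewrite ler_wpM2l //.
    by rewrite !mulr_ge0 ?invr_ge0 ?exprn_ge0.
  by rewrite ler_wpM2l // mulr_ge0 // invr_ge0.
have yU0 : 0 <= y ^- s.-1 * U by rewrite mulr_ge0 // invr_ge0 exprn_ge0 // ltW.
apply: (@le_trans _ _ (Q ^+ (k * p.+1) * p.+1%:R^-1 *
    (y ^+ (2 * s) * Q ^+ (2 * p.+1)) * (y ^- s.-1 * U))).
  rewrite ler_wpM2r //; apply: ler_pM => //.
    by rewrite !mulr_ge0 ?invr_ge0 ?exprn_ge0.
  by rewrite ler_wpM2l ?exprn_ge0.
have -> : Q ^+ (k * p.+1) / p.+1%:R * (y ^+ (2 * s) * Q ^+ (2 * p.+1)) * (y ^- s.-1 * U) =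
    Q ^+ (k.+2 * p.+1) / p.+1%:R * (4 / 3) * (y ^+ s.+1 * (1 + 3 / 4 * y) ^+ j.+1).
  (* The exponent [s + 1] is what [y ^- (s - 1)] leaves of [y ^ (2 * s)]. *)
  have -> : (2 * s = s.+1 + s.-1)%N by rewrite mul2n -addnn addSnnS prednK.
  have -> : (k.+2 * p.+1 = k * p.+1 + 2 * p.+1)%N by rewrite -mulnDl addn2.
  rewrite !(exprD y) (exprD Q) /U; field.
  by rewrite !expf_neq0 ?gt_eqF.
have -> : Q ^+ (k.+2 * p.+1) * (8 / 3) / p.+1%:R * expR (- (x / 4)) =
  Q ^+ (k.+2 * p.+1) / p.+1%:R * (4 / 3) * (2 * expR (- (x / 4))) by field; rewrite gt_eqF.
by rewrite ler_wpM2l // !mulr_ge0 ?exprn_ge0 ?invr_ge0.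
Qed.

(** Powers of [n / p] stay bounded, where [n = p + 1]. Since [j * (n - j) / n] is at least half of
    the smaller of [j] and [n - j], each exponential is at most [b ^ j + b ^ (n - j)] with
    [b = exp (- 1 / 8)]. Two geometric series remain. *)
Lemma sum_union_term_le (k p : nat) : (2 <= k)%N -> (0 < p)%N ->
  \sum_(j < p.+1 | (0 < j)%N) union_term R k p j <=
    expR (k.+2 * 2)%:R * (16 / 3) / (1 - expR (- 8^-1)) / p.+1%:R.
Proof.
move=> k2 p0.
have P0 : (0 : R) < p%:R by rewrite ltr0n.
have N0 : (0 : R) < p.+1%:R by rewrite ltr0n.
pose b : R := expR (- 8^-1).
have b0 : 0 < b := expR_gt0 _.
have b1 : b < 1 by rewrite -expR0 ltr_expR; lra.
have Q_le : (p.+1%:R / p%:R : R) ^+ (k.+2 * p.+1) <= expR (k.+2 * 2)%:R.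
  have QE : p.+1%:R / p%:R = 1 + p%:R^-1 :> R.
    by rewrite -natr1 mulrDl mulfV ?gt_eqF // mul1r.
  apply: (@le_trans _ _ (expR p%:R^-1 ^+ (k.+2 * p.+1))).
    rewrite lerXn2r ?nnegrE ?expR_ge0 //.
    by rewrite QE expR_ge1Dx.
  rewrite -expRM_natl ler_expR !natrM -mulrA ler_wpM2l // QE.
  have : p%:R^-1 <= (1 : R) by rewrite invf_le1 // ler1n.
  lra.
have geo : \sum_(j < p.+1) b ^+ j <= (1 - b)^-1.
  rewrite -[leRHS]mul1r ler_pdivlMr ?subr_gt0 //.
  have := subrX1 b p.+1; have : 0 <= b ^+ p.+1 by rewrite exprn_ge0 // ltW.
  move: (\sum_(j < p.+1) b ^+ j) (b ^+ p.+1) => S x; lra.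
have bX m : b ^+ m = expR (- (m%:R / 8)).
  by rewrite -expRM_natl mulrN.
have ej (j : nat) : (0 < j <= p)%N ->
    expR (- (j%:R * (p.+1 - j)%:R / p.+1%:R / 4)) <= b ^+ j + b ^+ (p.+1 - j).
  case/andP => j0 jp; have : j%:R + (p.+1 - j)%:R = p.+1%:R :> R.
    by rewrite -natrD subnKC // leqW.
  rewrite !bX; move: (p.+1 - j)%N => s E.
  have J0 : (0 : R) <= j%:R by [].
  have S0 : (0 : R) <= s%:R by [].
  have e1 := expR_ge0 (- (j%:R / 8) : R); have e2 := expR_ge0 (- (s%:R / 8) : R).
  have [le|le] := leP (j%:R : R) s%:R.
    apply: (@le_trans _ _ (expR (- (j%:R / 8)))); last by lra.
    rewrite ler_expR lerN2 -mulrA -mulrA ler_wpM2l //.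
    rewrite mulrA ler_pdivlMr // ler_pdivlMr // -E; lra.
  apply: (@le_trans _ _ (expR (- (s%:R / 8)))); last by lra.
  rewrite ler_expR lerN2 (mulrC j%:R) -mulrA -mulrA ler_wpM2l //.
  rewrite mulrA ler_pdivlMr // ler_pdivlMr // -E; lra.
have rev : \sum_(j < p.+1) b ^+ (p.+1 - j) <= (1 - b)^-1.
  apply: le_trans geo; rewrite (reindex_inj rev_ord_inj) /=; apply: ler_sum => j _.
  by rewrite ler_wiXn2l ?ltW //; have := ltn_ord j; lia.
have A0 := expR_ge0 ((k.+2 * 2)%:R : R).
apply: (@le_trans _ _ (\sum_(j < p.+1) (expR (k.+2 * 2)%:R * (8 / 3) / p.+1%:R *
    (b ^+ j + b ^+ (p.+1 - j))))).
  rewrite big_mkcond /=; apply: ler_sum => j _; case: ifP => [j0|_]; last first.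
    by rewrite !mulr_ge0 ?addr_ge0 ?exprn_ge0 ?invr_ge0 // ltW.
  have jp : (0 < j <= p)%N by rewrite j0 -ltnS ltn_ord.
  apply: le_trans (union_term_le k2 jp) _.
  apply: ler_pM; rewrite ?expR_ge0 //; last exact: ej.
  by rewrite ler_wpM2r ?invr_ge0 // ler_wpM2r.
rewrite -mulr_sumr big_split /=.
have -> : expR (k.+2 * 2)%:R * (16 / 3) / (1 - b) / p.+1%:R =
  expR (k.+2 * 2)%:R * (8 / 3) / p.+1%:R * ((1 - b)^-1 + (1 - b)^-1) :> R.
  by field; rewrite !gt_eqF // subr_gt0.
by rewrite ler_wpM2l ?lerD // !mulr_ge0 ?invr_ge0.
Qed.

End Decay.

(** * Convergence of the success probability *)

Unset Implicit Arguments.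
Local Open Scope classical_set_scope.
Local Open Scope ring_scope.

Theorem theorem1 (R : realType) (k : nat) (hk : (2 <= k)%N)
  (q : nat -> nat) (hq : forall n : nat, (n - 1 <= q n)%N)
  (pop : forall n : nat, {set 'I_(q n)})
  (hpop : forall n : nat, (0 < q n)%N ->
     #|pop n| = (k * n - q n * ((k * n) %/ q n))%N) :
  prob_rainbow_spanning_tree R n k (pop n) @[n --> \oo] --> (1 : R).
Proof.
(* The shift to [n = p + 1] makes [p = n - 1] the variable of the finite bounds. *)
rewrite -(cvg_shiftS (fun n => prob_rainbow_spanning_tree R n k (pop n))).
pose C : R := expR (k.+2 * 2)%:R * (16 / 3) / (1 - expR (- 8^-1)).
apply: (@squeeze_cvgr _ _ _ _ (fun p => 1 - C * p.+1%:R^-1) (fun=> 1)).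
- near=> p.
  have kp : (k <= p)%N by near: p; exact: nbhs_infty_ge.
  have p0 : (0 < p)%N by apply: leq_trans kp; apply: ltnW.
  have pq : (p <= q p.+1)%N by have := hq p.+1; rewrite subn1.
  have cardpop := hpop p.+1 (leq_trans p0 pq).
  rewrite prob_le1 // andbT lerBlDr addrC -lerBlDr.
  apply: le_trans (failure_le R hk kp pq cardpop) _.
  exact: sum_union_term_le.
- have : (1 - C * p.+1%:R^-1 : R) @[p --> \oo] --> 1 - C * 0.
    apply: cvgB; first exact: cvg_cst.
    by apply: cvgMr; exact: cvg_harmonic.
  by rewrite mulr0 subr0.
- exact: cvg_cst.
Unshelve. all: by end_near.
Qed.
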